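(* The output of the algorithm TautPolynomial (described in the context) applied to a (transverse taut) veering triangulation $\mathcal{V}=((T,F,E),\alpha,\nu)$ of a 3-manifold $M$ is equal to the taut polynomial $\Theta_{\mathcal{V}}$ of $\mathcal{V}$ (as elements of $\mathbb{Z}[H]\cong\mathbb{Z}[u_1^{\pm1},\dots,u_r^{\pm1}]$, up to a unit).
   Context: $M$ is a compact, oriented, connected 3-manifold with a finite positive number of toroidal boundary components (viewed as cusps), with an ideal triangulation $\mathcal{T}=(T,F,E)$: $T,F,E$ are the sets of ideal tetrahedra, triangles and edges, with $|T|=|E|=n$, $|F|=2n$. Triangles/tetrahedra attached to an edge are counted with embeddings. Transverse taut: a coorientation $\alpha$ is given on every triangle such that for each tetrahedron $t$ two faces (top faces) are cooriented out of $t$ and two (bottom faces) into $t$; $t$ is immediately below its top faces and immediately above its bottom faces. The top (bottom) diagonal of $t$ is the common edge of its two top (bottom) faces; the other four edges are equatorial. Assign angle $\pi$ to the diagonals and $0$ to the equatorial edges; for each $e\in E$ the angles over all embeddings of $e$ into tetrahedra must sum to $2\pi$. So each $e$ is the top diagonal of one tetrahedron (immediately below $e$) and the bottom diagonal of one (immediately above $e$), and the triangles attached to $e$ form two sides (left and right), each ordered from bottom to top by the coorientation. Veering: a transverse taut triangulation with a colouring $\nu$ of the edges red/blue such that in each tetrahedron, viewed from above (coorientation towards the viewer, using the orientation of $M$) and drawn with vertical top diagonal and horizontal bottom diagonal, the equatorial edges of positive slope are red and those of negative slope are blue. Let $H=H_1(M;\mathbb{Z})/\text{torsion}$ (multiplicative),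 of rank $r$; $M^{ab}\to M$ the maximal free abelian cover with deck group $H$; $\mathcal{V}^{ab}$ the lifted triangulation. Fix a connected fundamental domain whose closure is triangulated by one lift $1\cdot t$ of each $t\in T$; other tetrahedra are $h\cdot t$. Triangles and edges inherit their $H$-coefficient from the tetrahedron immediately below them. Taut polynomial: let $D^L:\mathbb{Z}[H]^F\to\mathbb{Z}[H]^E$ be the $\mathbb{Z}[H]$-homomorphism with $D^L(1\cdot f)=x_0-x_1-x_2$, where $x_0,x_1,x_2$ are the edges of $1\cdot f$ and $x_0$ is the top diagonal of the tetrahedron immediately below $1\cdot f$. Then $\Theta_{\mathcal{V}}$ is the gcd of the $n\times n$ minors of $D^L$, well-defined up to a unit ($0$ if all vanish). (Using instead the bottom diagonal of the tetrahedron immediately above $1\cdot f$ as $x_0$ gives the same polynomial up to a unit.) Dual graph $X$: vertex for each $t\in T$; for each $f\in F$ an edge, oriented upwards (from the tetrahedron immediately below $f$ to the one immediately above). Subroutine FacePairings (with empty list of extra cycles). Let $B:\mathbb{Z}^E\to\mathbb{Z}^F$ be the branch equations matrix ($2n\times n$): $B(e)=(f_1+\dots+f_k)-(f'_1+\dots+f'_{d-k})$, where $f_1,\dots,f_k$ are the triangles attached to $e$ on its right and $f'_1,\dots,f'_{d-k}$ those on its left. Choose a spanning tree $Y$ of $X$ and delete from $B$ the rows of triangles dual to edges of $Y$, giving $B_Y$ of size $(n+1)\times n$. Compute a Smith normal form $S=UB_YV$ with $U,V$ invertible over $\mathbb{Z}$ and the zero rows of $S$ last; the number of zero rows is $r$.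 The output is the tuple of face Laurents $\Lambda(f)$: $\Lambda(f)=1$ if $f$ is dual to an edge of $Y$, and otherwise $\Lambda(f)=u^{v}=u_1^{v_1}\cdots u_r^{v_r}$, where $v\in\mathbb{Z}^r$ consists of the last $r$ entries of the column of $U$ indexed by $f$. Here $H$ is identified with the Laurent monomials in $u_1,\dots,u_r$ through the basis of $H$ given by the last $r$ columns of $U^{-1}$, viewed as 1-cycles in $X/Y$. Algorithm TautPolynomial. Input: $\mathcal{V}$. (1) Compute the face Laurents $\Lambda$ by FacePairings. (2) Let $D$ be the zero matrix with rows indexed by $E$ and columns by $F$. For each $e\in E$ and for each of the two lists $A=(A[1],\dots,A[\ell])$ of triangles attached to $e$ on one side, ordered from bottom to top: add $1$ to the entry $(e,A[1])$ of $D$, and for $i=2,\dots,\ell$ subtract $\prod_{j=1}^{i-1}\Lambda(A[j])^{-1}$ from the entry $(e,A[i])$ of $D$. (3) Choose a spanning tree $Y$ of $X$ and delete from $D$ the columns of triangles dual to edges of $Y$, giving $D_Y$. (4) Return the gcd of the $n\times n$ minors of $D_Y$. *)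

(* Defs.v *)
From HB Require Import structures.
From mathcomp Require Import all_boot perm all_algebra.
From mathcomp Require Import boolp finmap.
From mathcomp Require Import monalg.

Set Implicit Arguments.
Unset Strict Implicit.
Unset Printing Implicit Defensive.

Import GRing.Theory.

Local Open Scope ring_scope.

(* The integral group ring of an abelian group G, written additively: the
   group element h is the ring element gmon h, and gmon (h + k) is
   gmon h * gmon k.  The carrier is that of finitely supported functions
   G -> int; the library puts a product on it only when the only invertible
   element of G is the neutral one, hence the ring structure below.
   For G = 'rV[int]_r this is the ring of Laurent polynomials in r variables,
   gmon v being the monomial of exponent v. *)
Definition groupring (G : zmodType) := {malg int[G]}.

HB.instance Definition _ (G : zmodType) := GRing.Zmodule.on (groupring G).

Section GroupRing.
Variable G : zmodType.
Implicit Types (x y z : groupring G) (h k : G).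

Definition gmon h : groupring G := mkmalgU h 1.

Definition gmul x y : groupring G :=
  \sum_(h <- msupp x) \sum_(k <- msupp y) mkmalgU (h + k) (x@_h * y@_k).

Lemma gmulE (dx dy : {fset G}) x y :
    (msupp x `<=` dx)%fset -> (msupp y `<=` dy)%fset ->
  gmul x y = \sum_(h <- dx) \sum_(k <- dy) mkmalgU (h + k) (x@_h * y@_k).
Proof.
move=> sx sy; rewrite /gmul (big_fset_incl _ sx) /=.
  apply/eq_bigr=> h _; apply/big_fset_incl => // k _ /mcoeff_outdom ->.
  by rewrite mulr0 monalgU0.
move=> h _ /mcoeff_outdom xh.
by rewrite big1 // => k _; rewrite xh mul0r monalgU0.
Qed.

Lemma gmulUU a b h k :
  gmul (mkmalgU h a) (mkmalgU k b) = mkmalgU (h + k) (a * b).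
Proof. by rewrite (gmulE msuppU_le msuppU_le) !big_seq_fset1 !mcoeffUU. Qed.

Lemma gmulC : commutative gmul.
Proof.
move=> x y; rewrite /gmul exchange_big; apply/eq_bigr=> h _.
by apply/eq_bigr=> k _; rewrite addrC mulrC.
Qed.

Lemma gmulDl : left_distributive gmul +%R.
Proof.
move=> x y z; set d := (msupp x `|` msupp y)%fset.
rewrite (@gmulE d (msupp z)) ?msuppD_le ?fsubset_refl //.
rewrite (@gmulE d (msupp z) x) ?fsubsetUl ?fsubset_refl //.
rewrite (@gmulE d (msupp z) y) ?fsubsetUr ?fsubset_refl //.
rewrite -big_split /=; apply/eq_bigr=> h _.
rewrite -big_split /=; apply/eq_bigr=> k _.
by rewrite mcoeffD mulrDl monalgUD.
Qed.

Lemma gmul0 : left_zero 0 gmul.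
Proof. by move=> x; rewrite /gmul msupp0 big_seq_fset0. Qed.

Lemma gmulr0 : right_zero 0 gmul.
Proof. by move=> x; rewrite gmulC gmul0. Qed.

Lemma gmulDr : right_distributive gmul +%R.
Proof. by move=> x y z; rewrite gmulC gmulDl !(gmulC _ x). Qed.

Lemma gmul1 : left_id (gmon 0) gmul.
Proof.
move=> x; rewrite (gmulE msuppU_le (fsubset_refl _)) big_seq_fset1.
rewrite [RHS]monalgE; apply/eq_bigr=> k _.
by rewrite mcoeffUU mul1r add0r.
Qed.

Lemma gmul_suml I (s : seq I) (F : I -> groupring G) y :
  gmul (\sum_(i <- s) F i) y = \sum_(i <- s) gmul (F i) y.
Proof.
exact: (big_morph (gmul^~ y) (fun x1 x2 => gmulDl x1 x2 y) (gmul0 y)).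
Qed.

Lemma gmul_sumr I (s : seq I) (F : I -> groupring G) x :
  gmul x (\sum_(i <- s) F i) = \sum_(i <- s) gmul x (F i).
Proof. exact: (big_morph (gmul x) (gmulDr x) (gmulr0 x)). Qed.

Lemma gmulEl x y : gmul x y = \sum_(h <- msupp x) gmul (mkmalgU h x@_h) y.
Proof. by rewrite -gmul_suml -monalgE. Qed.

Lemma gmulEr x y : gmul x y = \sum_(k <- msupp y) gmul x (mkmalgU k y@_k).
Proof. by rewrite -gmul_sumr -monalgE. Qed.

Lemma gmulA : associative gmul.
Proof.
move=> x y z; rewrite (gmulEl x (gmul y z)) (gmulEl x y) gmul_suml.
apply: eq_bigr=> h _; rewrite (gmulEl y z) (gmulEr _ y) gmul_sumr gmul_suml.
apply: eq_bigr=> k _; rewrite (gmulEr _ z) (gmulEr (gmul _ _) z) gmul_sumr.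
by apply: eq_bigr=> l _; rewrite !gmulUU mulrA addrA.
Qed.

Lemma gmon0_neq0 : gmon 0 != 0.
Proof. by rewrite monalgU_eq0 oner_eq0. Qed.

HB.instance Definition _ := GRing.Zmodule_isComNzRing.Build (groupring G)
  gmulA gmulC gmul1 gmulDl gmon0_neq0.

End GroupRing.

Definition gmap (G G' : zmodType) (phi : G -> G') (x : groupring G) :
    groupring G' :=
  \sum_(h <- msupp x) mkmalgU (phi h) (x@_h).

Section Gcd.
Variable R : comNzRingType.

Definition divides (a b : R) := exists c, b = a * c.

Definition is_gcd (S : R -> Prop) (d : R) :=
  (forall x, S x -> divides d x) /\
  (forall c, (forall x, S x -> divides c x) -> divides c d).

Definition is_unit (u : R) := exists v, u * v = 1.

Definition equal_up_to_unit (a b : R) := exists2 u, is_unit u & a = u * b.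

Definition is_minor k m n (A : 'M[R]_(m, n)) (x : R) :=
  exists (f : 'I_k -> 'I_m) (g : 'I_k -> 'I_n),
    [/\ {homo f : i j / (i < j)%N}, {homo g : i j / (i < j)%N}
      & x = \det (mxsub f g A)].

End Gcd.

Definition v0 : 'I_4 := @Ordinal 4 0 isT.
Definition v1 : 'I_4 := @Ordinal 4 1 isT.
Definition v2 : 'I_4 := @Ordinal 4 2 isT.
Definition v3 : 'I_4 := @Ordinal 4 3 isT.

(* (t, i, j) stands for the edge of the model tetrahedron t joining its
   vertices i and j; it is related to its reverse and to its images under the
   gluings of the two faces of t that contain it. *)
Definition edge_step (T : finType) (adj : T -> 'I_4 -> T)
    (glue : T -> 'I_4 -> 'S_4) : rel (T * 'I_4 * 'I_4) :=
  fun x y => let: (t, i, j) := x in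
    (y == (t, j, i)) ||
    [exists k, [&& k != i, k != j & y == (adj t k, glue t k i, glue t k j)]].

(* An oriented connected ideal triangulation.  The vertices of every model
   tetrahedron are labelled by 'I_4 so that (0,1,2,3) is positively oriented,
   i.e. the vectors from 0 to 1, 2, 3 form a positive basis.  Face i of t is the
   one opposite to vertex i.  It is glued to face glue t i i of adj t i, and
   every vertex j != i of t to the vertex glue t i j.  As orientations are
   respected, glue t i is an odd permutation. *)
Record ideal_triangulation := IdealTriangulation {
  tet : finType;
  tri : finType;
  edg : finType;
  adj : tet -> 'I_4 -> tet;
  glue : tet -> 'I_4 -> 'S_4;
  adjK : forall t i, adj (adj t i) (glue t i i) = t;
  glueK : forall t i, glue (adj t i) (glue t i i) = ((glue t i)^-1)%g;
  glue_neq : forall t i, (adj t i, glue t i i) <> (t, i);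
  glue_odd : forall t i, odd_perm (glue t i);
  tet_gt0 : (0 < #|tet|)%N;
  tet_connected :
    forall t t', connect (fun x y => [exists i, adj x i == y]) t t';
  tri_of : tet -> 'I_4 -> tri;
  tri_of_eq : forall t i t' i', tri_of t i = tri_of t' i' <->
    (t', i') = (t, i) \/ (t', i') = (adj t i, glue t i i);
  tri_of_onto : forall f, exists t i, tri_of t i = f;
  edg_of : tet -> 'I_4 -> 'I_4 -> edg;
  edg_of_eq : forall t i j t' i' j', i != j -> i' != j' ->
    (edg_of t i j = edg_of t' i' j' <->
     connect (edge_step adj glue) (t, i, j) (t', i', j'));
  edg_of_onto : forall e, exists t i j, i != j /\ edg_of t i j = e
}.

(* Edge ij of t is the common edge of the two faces opposite to the other two
   vertices. *)
Definition common_edge (A : {set 'I_4}) (i j : 'I_4) :=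
  (i != j) && (A == ~: [set i; j]).

(* up t i means that face i of t is cooriented out of t, i.e. is a top face.
   Angles are counted in units of pi.  The angle condition gives every vertex
   link, a closed oriented surface, Euler characteristic 0: the boundary
   components are tori, and this need not be required separately. *)
Record transverse_taut := TransverseTaut {
  tt_tri :> ideal_triangulation;
  up : tet tt_tri -> 'I_4 -> bool;
  up_glue : forall t i, up (adj t i) (glue t i i) = ~~ up t i;
  up_card : forall t, #|[set i | up t i]| = 2%N;
  angle_sum : forall e : edg tt_tri,
    (\sum_(t : tet tt_tri) \sum_(i < 4) \sum_(j < 4 | (i < j)%N && (edg_of t i j == e))
      (common_edge [set i | up t i] i j || common_edge [set i | ~~ up t i] i j)
     = 2)%N
}.

Definition top_diagonal (V : transverse_taut) (t : tet V) :=
  common_edge [set i | up t i].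

Inductive colour := Red | Blue.

(* Seen from above, with the top diagonal (s v0, s v1) going from South to
   North, evenness of s puts s v2 in the East and s v3 in the West.  The edge
   (s v0, s v2) then has positive slope, (s v0, s v3) negative slope, and the
   other two equatorial edges are obtained by turning the picture around, that
   is by exchanging s v0 with s v1 and s v2 with s v3. *)
Record veering_triangulation := VeeringTriangulation {
  vt_tt :> transverse_taut;
  colour_of : edg vt_tt -> colour;
  colour_veering : forall (t : tet vt_tt) (s : 'S_4), ~~ odd_perm s ->
    top_diagonal t (s v0) (s v1) ->
    colour_of (edg_of t (s v0) (s v2)) = Red /\
    colour_of (edg_of t (s v0) (s v3)) = Blue
}.

Section Taut.
Variable V : transverse_taut.

(* A flag (t, s) singles out the oriented edge (s v0, s v1) of t and, among the
   two faces of t containing it, the face opposite to s v3, through which one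
   leaves t when rotating around that edge.  Even flags all rotate in the same
   direction with respect to the orientation of their edge. *)
Definition flag := (tet V * 'S_4)%type.

Definition flag_edge (c : flag) : edg V := edg_of c.1 (c.2 v0) (c.2 v1).
Definition across (c : flag) : tri V := tri_of c.1 (c.2 v3).
Definition goes_up (c : flag) : bool := up c.1 (c.2 v3).

Definition rotate_flag (c : flag) : flag :=
  (adj c.1 (c.2 v3), (tperm v2 v3 * c.2 * glue c.1 (c.2 v3))%g).

Definition reverse_flag (c : flag) : flag :=
  (c.1, (tperm v0 v1 * tperm v2 v3 * c.2)%g).

(* The tetrahedron of c is immediately below the edge of c. *)
Definition below_edge (c : flag) : bool := top_diagonal c.1 (c.2 v0) (c.2 v1).

Definition base_flag (e : edg V) (c : flag) : bool :=
  [&& ~~ odd_perm c.2, flag_edge c == e & below_edge c].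

(* For a base flag c of e, the triangles attached to e on its right, from bottom
   to top, where right is as seen from above with e pointing up the page.  The
   left-hand side of e is the right-hand side of the reversed flag. *)
Definition side (c : flag) : seq (tri V) :=
  let p := orbit rotate_flag c in
  [seq across d | d <- take (find (fun d => ~~ goes_up d) p) p].

(* H_1(M) is computed from the dual 2-complex, onto which M deformation
   retracts.  Its 1-skeleton is the dual graph X, with an edge for every
   triangle, oriented upwards, and it has one 2-cell for every edge e, attached
   along the loop of X going once around e. *)
Definition chain1 := {ffun tri V -> int}.

Definition bdry1 (z : chain1) : {ffun tet V -> int} :=
  [ffun t => \sum_(i | ~~ up t i) z (tri_of t i)
             - \sum_(i | up t i) z (tri_of t i)].

Definition bdry2 (c : flag) : chain1 :=
  [ffun f => \sum_(d <- orbit rotate_flag c | across d == f)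
               (if goes_up d then 1 else -1)].

Definition cycle_pred (z : chain1) : bool := bdry1 z == 0.

Lemma cycle_closed : zmod_closed cycle_pred.
Proof.
split=> [|x y]; rewrite ?unfold_in.
  by apply/eqP/ffunP=> t; rewrite !ffunE !big1 ?subrr // => i; rewrite ffunE.
move=> /eqP/ffunP x0 /eqP/ffunP y0; apply/eqP/ffunP=> t; move: (x0 t) (y0 t).
rewrite !ffunE => /eqP; rewrite subr_eq0 => /eqP xt /eqP; rewrite subr_eq0.
move=> /eqP yt; apply/eqP; rewrite subr_eq0; apply/eqP.
transitivity (\sum_(i | ~~ up t i) x (tri_of t i)
              - \sum_(i | ~~ up t i) y (tri_of t i)).
  by rewrite -sumrB; apply: eq_bigr => i _; rewrite !ffunE.
by rewrite xt yt -sumrB; apply: eq_bigr => i _; rewrite !ffunE.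
Qed.

HB.instance Definition _ := GRing.isZmodClosed.Build chain1 cycle_pred cycle_closed.

Record cycle1 := Cycle1 { cycle_val :> chain1; _ : cycle_val \in cycle_pred }.

HB.instance Definition _ := [isSub for cycle_val].
HB.instance Definition _ := [Choice of cycle1 by <:].
HB.instance Definition _ := [SubChoice_isSubZmodule of cycle1 by <:].

Definition torsion_pred (z : cycle1) : bool :=
  `[< exists2 m, (0 < m)%N &
      exists k : flag -> int, (z : chain1) *+ m = \sum_c bdry2 c *~ k c >].

Lemma torsion_closed : zmod_closed torsion_pred.
Proof.
split=> [|x y /asboolP[m m0 [k xE]] /asboolP[n n0 [l yE]]]; apply/asboolP.
  exists 1%N => //; exists (fun=> 0); rewrite big1 ?mulr1n //.
exists (m * n)%N; first by rewrite muln_gt0 m0.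
exists (fun c => k c *+ n - l c *+ m).
have -> : (x - y : cycle1) = (x : chain1) - (y : chain1) :> chain1 by [].
rewrite mulrnBl [LHS](_ : _ = (x : chain1) *+ m *+ n - (y : chain1) *+ n *+ m).
  rewrite xE yE -!sumrMnl -sumrB; apply: eq_bigr => c _.
  have mzn (u : chain1) (a : int) (b : nat) : u *~ (a *+ b) = u *~ a *+ b.
    by rewrite -mulr_natr natz mulrzA -pmulrn.
  by rewrite mulrzBr !mzn.
by rewrite -!mulrnA [(n * m)%N]mulnC.
Qed.

HB.instance Definition _ :=
  GRing.isZmodClosed.Build cycle1 torsion_pred torsion_closed.

Definition torsion_boundaries : zmodClosed cycle1 :=
  GRing.ZmodClosed.clone cycle1 torsion_pred _.

Definition H1 : Type := Quotient.quot torsion_boundaries.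
HB.instance Definition _ := GRing.Zmodule.on H1.

Definition hclass (z : cycle1) : H1 := (\pi_(Quotient.quot torsion_boundaries) z)%qT.

(* A fundamental domain of the maximal free abelian cover is encoded by the
   function lam such that the triangle 1.f has the tetrahedron 1.t immediately
   below it and (lam f).t' immediately above it.  The lift of a loop of X then
   starts at 1.t and ends at h.t, where h is the sum of lam along the loop; the
   deck group being H, h has to be the class of the loop.  The second condition
   says that the tetrahedra 1.t are connected through the triangles in the
   interior of the domain. *)
Definition fundamental_domain (lam : tri V -> H1) :=
  (forall z : cycle1, \sum_f lam f *~ (z : chain1) f = hclass z) /\
  (forall t t' : tet V,
     connect (fun x y => [exists i, (lam (tri_of x i) == 0) && (adj x i == y)])
       t t').

Definition deck_step (lam : tri V -> H1) (c : flag) : H1 :=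
  if goes_up c then lam (across c) else - lam (across c).

(* The coefficient of the lift to 1.t of the edge of c = (t, s): rotating around
   that lift from 1.t, one reaches the tetrahedron h.t' immediately below it. *)
Definition edge_coeff (lam : tri V -> H1) (c : flag) : H1 :=
  let p := orbit rotate_flag c in
  \sum_(d <- take (find below_edge p) p) deck_step lam d.

(* The (e, f) entry of D^L.  The flags in the sum are at the tetrahedron t
   immediately below f, f being opposite to s v2, and run over the three edges
   of f. *)
Definition DL_entry (lam : tri V -> H1) (e : edg V) (f : tri V) :
    groupring H1 :=
  \sum_(c : flag | [&& ~~ odd_perm c.2, up c.1 (c.2 v2),
                       tri_of c.1 (c.2 v2) == f & flag_edge c == e])
    (if below_edge c then 1 else -1) * gmon (edge_coeff lam c).

Definition DL (lam : tri V -> H1) : 'M[groupring H1]_(#|edg V|, #|tri V|) :=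
  \matrix_(i, j) DL_entry lam (enum_val i) (enum_val j).

Definition is_taut_polynomial (lam : tri V -> H1) (Theta : groupring H1) :=
  is_gcd (is_minor #|tet V| (DL lam)) Theta.

Definition tree_adj (Y : {set tri V}) : rel (tet V) :=
  fun t t' => [exists i, (tri_of t i \in Y) && (adj t i == t')].

(* Connected, and such that no edge of Y lies on a cycle of Y. *)
Definition spanning_tree (Y : {set tri V}) :=
  (forall t t', connect (tree_adj Y) t t') /\
  (forall t i, tri_of t i \in Y ->
     ~~ connect (tree_adj (Y :\ tri_of t i)) t (adj t i)).

(* R chooses, for every edge, the direction in which it points, that is which
   of its sides is the right-hand one. *)
Definition branch_entry (R : edg V -> flag) (f : tri V) (e : edg V) : int :=
  (count_mem f (side (R e)))%:Z - (count_mem f (side (reverse_flag (R e))))%:Z.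

Definition branch_matrix (R : edg V -> flag) (Y : {set tri V}) :
    'M[int]_(#|~: Y|, #|edg V|) :=
  \matrix_(i, j) branch_entry R (enum_val i) (enum_val j).

Definition smith_normal m n (S : 'M[int]_(m, n)) :=
  exists2 d : seq int, sorted dvdz d &
    S = \matrix_(i, j) (d`_i *+ (i == j :> nat)).

Record face_pairings := FacePairings {
  fp_tree : {set tri V};
  fp_treeP : spanning_tree fp_tree;
  fp_right : edg V -> flag;
  fp_rightP : forall e, base_flag e (fp_right e);
  fp_U : 'M[int]_#|~: fp_tree|;
  fp_V : 'M[int]_#|edg V|;
  fp_S : 'M[int]_(#|~: fp_tree|, #|edg V|);
  fp_U_unit : fp_U \in unitmx;
  fp_V_unit : fp_V \in unitmx;
  fp_smith : smith_normal fp_S;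
  fp_S_eq : fp_S = fp_U *m branch_matrix fp_right fp_tree *m fp_V
}.

Definition fp_rank (p : face_pairings) : nat := #|[set i | row i (fp_S p) == 0]|.

Lemma fp_rank_le p : (fp_rank p <= #|~: fp_tree p|)%N.
Proof. by rewrite -[leqRHS]card_ord max_card. Qed.

(* The last fp_rank p indices, in increasing order. *)
Definition fp_last (p : face_pairings) (k : 'I_(fp_rank p)) :
    'I_#|~: fp_tree p| :=
  rev_ord (widen_ord (fp_rank_le p) (rev_ord k)).

(* The exponent v of the face Laurent Lambda(f) = u^v.  The sum has one term, or
   none when f is in the tree. *)
Definition face_laurent (p : face_pairings) (f : tri V) : 'rV[int]_(fp_rank p) :=
  \row_k \sum_(j | enum_val j == f) fp_U p (fp_last k) j.

(* z k is the 1-cycle of X whose image in X/Y is the k-th of the last columns of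
   the inverse of U; as Y is a tree, such a cycle exists and is unique. *)
Definition fp_basis (p : face_pairings) (z : 'I_(fp_rank p) -> cycle1) :=
  forall k, \col_j (z k : chain1) (enum_val j) = col (fp_last k) (invmx (fp_U p)).

(* The identification of Laurent monomials with elements of H. *)
Definition monomial_class r (z : 'I_r -> cycle1) (v : 'rV[int]_r) : H1 :=
  \sum_k hclass (z k) *~ v 0 k.

Definition side_entry r (Lam : tri V -> 'rV[int]_r) (A : seq (tri V)) (f : tri V) :
    groupring 'rV[int]_r :=
  \sum_(i < size A | nth f A i == f)
    (if i == 0%N :> nat then 1 else - \prod_(g <- take i A) gmon (- Lam g)).

Definition D_entry r (Lam : tri V -> 'rV[int]_r) (e : edg V) (f : tri V) :
    groupring 'rV[int]_r :=
  \sum_(c | base_flag e c) side_entry Lam (side c) f.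

Definition D_tree r (Lam : tri V -> 'rV[int]_r) (Y : {set tri V}) :
    'M[groupring 'rV[int]_r]_(#|edg V|, #|~: Y|) :=
  \matrix_(i, j) D_entry Lam (enum_val i) (enum_val j).

(* P is a value that the algorithm may return after having chosen p in step 1
   and the spanning tree Y in step 3; gcds are only defined up to a unit. *)
Definition TautPolynomial_returns (p : face_pairings) (Y : {set tri V})
    (P : groupring 'rV[int]_(fp_rank p)) :=
  is_gcd (is_minor #|tet V| (D_tree (face_laurent p) Y)) P.

End Taut.

(* Main.v *)
From HB Require Import structures.
Require Import Defs.
From mathcomp Require Import all_boot all_order perm all_algebra ring.
From mathcomp Require Import boolp finmap monalg.
Import GRing.Theory Num.Theory Order.TTheory.

Set Implicit Arguments.
Unset Strict Implicit.
Unset Printing Implicit Defensive.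

(** The matrix [D] of the algorithm and the matrix [DL] of the definition agree up
    to units, and deleting the columns of a spanning tree from [DL] leaves the
    common divisors of its minors unchanged.  Three independent arguments carry
    this.

    Homology.  The 2-dimensional boundaries in the dual complex are spanned by
    the loops around the edges, which off the tree are the columns of the branch
    matrix ([branch_bdry2], [bdry2_span]).  A cycle of the dual graph is
    determined by its coefficients off a spanning tree, so Smith normal form shows that the last coordinates [U w], which are the values of the face
    Laurents on the cycle [w], vanish exactly when [w] is torsion modulo
    boundaries ([hclass_eq0_laurent]).  Hence monomials and homology classes
    correspond bijectively, and the face Laurents compute homology classes
    ([hclass_laurent], [monomial_class_inv]).

    Comparison of entries.  The angle condition forces the tetrahedra around an
    edge to form a cycle with one tetrahedron below the edge and one above it
    ([below_unique], [exists_below]).  Walking up a side from below, the product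
    of the inverse face Laurents is the coefficient of the edge, up to the
    difference between two cochains that agree on all cycles.  Such a difference
    is a coboundary ([potential]), which turns into a unit for every row and a
    unit for every column ([DL_gmap_D_entry]).

    Deleting columns.  In a veering triangulation the four triangles of a
    tetrahedron have linearly dependent columns in [DL], all coefficients being
    units: the colours tell which edge of a bottom triangle is the top diagonal
    of the tetrahedron below it ([veering_triangle]), and then the differences of
    the two top columns and of the two bottom columns are equal up to sign
    ([tetrahedron_relation]).  Starting from the leaves of a spanning tree, these
    relations express the columns of the tree by the other ones, and the minors
    of a product [B *m C] are combinations of the minors of [B]
    ([common_divisor_mulmxr], [common_divisor_off_tree]).

    The conclusion follows since greatest common divisors are unique up to units
    in a Laurent polynomial ring, which is a domain ([laurent_mul_eq0]). *)

(** * Group rings *)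

Section GroupRingMaps.
Local Open Scope ring_scope.

Lemma gmonD (G : zmodType) (h k : G) : gmon (h + k) = gmon h * gmon k.
Proof. by rewrite [RHS]gmulUU mulr1. Qed.

Lemma gmon0 (G : zmodType) : gmon (0 : G) = 1.
Proof. by []. Qed.

Lemma gmon_sum (G : zmodType) I (s : seq I) (F : I -> G) :
  gmon (\sum_(i <- s) F i) = \prod_(i <- s) gmon (F i).
Proof. exact: (big_morph _ (@gmonD G) (gmon0 G)). Qed.

Lemma gmon_unit (G : zmodType) (h : G) : is_unit (gmon h).
Proof. by exists (gmon (- h)); rewrite -gmonD subrr. Qed.

Variables (G G' : zmodType) (phi : {additive G -> G'}).

Lemma gmapE (d : {fset G}) x : (msupp x `<=` d)%fset ->
  gmap phi x = \sum_(h <- d) mkmalgU (phi h) x@_h.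
Proof.
move=> sx; rewrite /gmap (big_fset_incl _ sx) //= => h _ /mcoeff_outdom ->.
by rewrite monalgU0.
Qed.

Lemma gmap_is_additive : zmod_morphism (gmap phi).
Proof.
move=> x y; set d := (msupp x `|` msupp y)%fset.
rewrite (@gmapE d (x - y)) ?msuppB_le // (@gmapE d x) ?fsubsetUl //.
rewrite (@gmapE d y) ?fsubsetUr // -sumrB; apply: eq_bigr => h _.
by rewrite mcoeffB monalgUB.
Qed.

Lemma gmapU h a : gmap phi (mkmalgU h a) = mkmalgU (phi h) a.
Proof. by rewrite (gmapE msuppU_le) big_seq_fset1 mcoeffUU. Qed.

HB.instance Definition _ :=
  GRing.isZmodMorphism.Build (groupring G) (groupring G') (gmap phi) gmap_is_additive.

Lemma gmap_gmon h : gmap phi (gmon h) = gmon (phi h).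
Proof. exact: gmapU. Qed.

Lemma gmap_is_multiplicative : monoid_morphism (gmap phi).
Proof.
split=> [|x y]; first by rewrite -!gmon0 gmap_gmon raddf0.
rewrite [x]monalgE [y]monalgE mulr_suml !(raddf_sum (gmap phi)) mulr_suml.
apply: eq_bigr => h _; rewrite mulr_sumr (raddf_sum (gmap phi)) mulr_sumr.
apply: eq_bigr => k _; rewrite /= !gmapU.
by rewrite [X in gmap phi X]gmulUU gmapU [RHS]gmulUU raddfD.
Qed.

HB.instance Definition _ :=
  GRing.isMonoidMorphism.Build (groupring G) (groupring G') (gmap phi)
    gmap_is_multiplicative.

End GroupRingMaps.

Section GroupRingIso.
Local Open Scope ring_scope.
Variables (G G' : zmodType) (phi : {additive G -> G'}) (psi : {additive G' -> G}).

Lemma gmapK : cancel phi psi -> cancel (gmap phi) (gmap psi).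
Proof.
move=> phiK x; rewrite [RHS]monalgE {1}[x]monalgE
  (raddf_sum (gmap phi)) (raddf_sum (gmap psi)).
apply: eq_bigr => h _.
by rewrite /= !gmapU phiK.
Qed.
End GroupRingIso.

Section LaurentDomain.
Local Open Scope ring_scope.
Variable r : nat.
Implicit Types (u v w : 'rV[int]_r) (x y : groupring 'rV[int]_r).

(** Positivity for the lexicographic order of exponents; the order itself is
    [fun u v => lexpos (v - u)]. *)
Definition lexpos v :=
  exists2 i : 'I_r, (forall j : 'I_r, (j < i)%N -> v 0 j = 0) & 0 < v 0 i.

Lemma lexpos0 : ~ lexpos 0.
Proof. by case=> i _; rewrite mxE ltxx. Qed.

Lemma lexposD u v : lexpos u -> lexpos v -> lexpos (u + v).
Proof.
move=> [i ui ui0] [j vj vj0]; case: (ltngtP i j) => [ij|ji|/val_inj ij].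
- exists i => [k ki|]; first by rewrite mxE ui // vj ?addr0 // (ltn_trans ki).
  by rewrite mxE vj // addr0.
- exists j => [k kj|]; first by rewrite mxE vj // ui ?addr0 // (ltn_trans kj).
  by rewrite mxE ui // add0r.
- exists i => [k ki|]; first by rewrite mxE ui // vj ?addr0 // -ij.
  by rewrite mxE addr_gt0 // ij.
Qed.

Lemma lexpos_total v : v != 0 -> lexpos v \/ lexpos (- v).
Proof.
move=> v0; have [i vi0] : exists i, v 0 i != 0.
  apply: contrapT => /forallNP vN; case/negP: v0; apply/eqP/rowP=> i.
  by rewrite mxE; apply/eqP/negPn/negP.
case: (@arg_minnP _ i (fun i => v 0 i != 0) val vi0) => k vk0 kmin.
have vk (j : 'I_r) : (j < k)%N -> v 0 j = 0.
  by move=> jk; apply/eqP; apply: contraTT jk => vj0; rewrite -leqNgt kmin.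
case: (ltrgt0P (v 0 k)) vk0 => // vk0 _; first by left; exists k.
by right; exists k => [j jk|]; rewrite mxE ?oppr_gt0 // vk ?oppr0.
Qed.

Lemma lexmax (s : seq 'rV[int]_r) : s != [::] ->
  exists2 m, m \in s & forall u, u \in s -> u != m -> lexpos (m - u).
Proof.
elim: s => // v s IHs _; have [->|/IHs[m ms mmax]] := altP (s =P [::]).
  by exists v; rewrite ?mem_seq1 // => u; rewrite mem_seq1 => ->.
have [vm|vm] := eqVneq v m.
  exists m; first by rewrite inE ms orbT.
  by move=> u; rewrite inE vm => /predU1P[->|/mmax//]; rewrite eqxx.
have /lexpos_total[mv|] : m - v != 0 by rewrite subr_eq0 eq_sym.
  exists m; first by rewrite inE ms orbT.
  by move=> u; rewrite inE => /predU1P[->//|/mmax].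
rewrite opprB => vm0; exists v; first exact: mem_head.
move=> u; rewrite inE => /predU1P[->|us _]; first by rewrite eqxx.
have [->//|um] := eqVneq u m.
by rewrite -(subrKA m); apply: lexposD => //; apply: mmax.
Qed.

Lemma coeffM x y w : (x * y)@_w =
  \sum_(h <- msupp x) \sum_(k <- msupp y) (x@_h * y@_k) *+ (h + k == w).
Proof.
rewrite [x * y]/(gmul x y) /gmul raddf_sum; apply: eq_bigr => h _.
by rewrite raddf_sum; apply: eq_bigr => k _; rewrite /= mcoeffU.
Qed.

(** The product of the lexicographically leading terms cannot be cancelled. *)
Lemma laurent_mul_eq0 x y : x * y = 0 -> x = 0 \/ y = 0.
Proof.
have lead z : z <> 0 -> exists2 m, m \in msupp z &
    forall u, u \in msupp z -> u != m -> lexpos (m - u).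
  move=> /eqP z0; apply: lexmax; apply: contra z0 => /eqP s0.
  by rewrite [z]monalgE big_seq big_pred0 // => h; rewrite -topredE /= s0.
move=> xy0; apply: contrapT => /not_orP[/lead[h hx hmax] /lead[k ky kmax]].
have := coeffM x y (h + k); rewrite xy0 mcoeff0.
rewrite (big_fsetD1 h) //= (big_fsetD1 k) //= eqxx mulr1n.
rewrite big_seq big1 ?addr0 => [|k' /fsetD1P[k'k k'y]]; last first.
  by rewrite (inj_eq (addrI h)) (negPf k'k).
rewrite big_seq big1 ?addr0 => [|h' /fsetD1P[h'h h'x]]; last first.
  rewrite big_seq big1 // => k' k'y; case: eqP => // hk.
  have pos_h : lexpos (h - h') by apply: hmax.
  have : k' - k = h - h' by apply/eqP; rewrite subr_eq addrAC -hk addrC addKr.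
  have [->|k'k] := eqVneq k' k; first by
    rewrite subrr => hh; move: pos_h; rewrite -hh => /lexpos0.
  move=> kk; have /(lexposD pos_h) : lexpos (k - k') by apply: kmax.
  by rewrite -(opprB k' k) kk subrr => /lexpos0.
by move/esym/eqP; rewrite mulf_eq0 !mcoeff_eq0 hx ky.
Qed.
End LaurentDomain.

(** * Greatest common divisors of minors *)

Section Minors.
Local Open Scope ring_scope.
Variable R : comNzRingType.

Lemma divides_mull (c a b : R) : divides c b -> divides c (a * b).
Proof. by case=> d ->; exists (a * d); rewrite mulrCA. Qed.

Lemma divides0 (c : R) : divides c 0.
Proof. by exists 0; rewrite mulr0. Qed.

Lemma dividesD (c a b : R) : divides c a -> divides c b -> divides c (a + b).
Proof. by case=> d -> [e ->]; exists (d + e); rewrite mulrDr. Qed.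

Lemma is_unit1 : is_unit (1 : R).
Proof. by exists 1; rewrite mulr1. Qed.

Lemma is_unitN1 : is_unit (-1 : R).
Proof. by exists (-1); rewrite mulrNN mulr1. Qed.

Lemma is_unitM (x y : R) : is_unit x -> is_unit y -> is_unit (x * y).
Proof.
by case=> x' xx' [y' yy']; exists (x' * y'); rewrite mulrACA xx' yy' mulr1.
Qed.

(** Multilinear expansion along the columns of the product.  Only the column
    choices [h] that are injective contribute, which makes this a form of the
    Cauchy-Binet formula. *)
Lemma det_mulmx_expand k m (A : 'M[R]_(k, m)) (B : 'M[R]_(m, k)) :
  \det (A *m B) =
  \sum_(h : {ffun 'I_k -> 'I_m}) (\prod_i B (h i) i) * \det (colsub h A).
Proof.
rewrite -[LHS]det_tr [LHS]/determinant.
transitivity (\sum_(s : 'S_k) \sum_(h : {ffun 'I_k -> 'I_m})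
   (\prod_i B (h i) i) * ((-1) ^+ s * \prod_i (colsub h A)^T i (s i))).
  apply: eq_bigr => s _.
  rewrite (eq_bigr (fun i => \sum_j A (s i) j * B j i)); last first.
    by move=> i _; rewrite !mxE.
  rewrite bigA_distr_bigA big_distrr /=; apply: eq_bigr => h _.
  rewrite mulrCA -big_split /=; congr (_ * _); apply: eq_bigr => i _.
  by rewrite !mxE mulrC.
rewrite exchange_big; apply: eq_bigr => h _; rewrite -mulr_sumr.
by rewrite -[in RHS]det_tr.
Qed.

Lemma increasing_rearrangement k m (g : 'I_k -> 'I_m) : injective g ->
  exists s : 'S_k, {homo (fun i => g (s i)) : i j / (i < j)%N}.
Proof.
move=> g_inj; pose t := [tuple g i | i < k].
pose leo (a b : 'I_m) := (a <= b)%N.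
have szt : size (sort leo t) == k by rewrite size_sort size_tuple.
have /tuple_permP[s sE] : perm_eq (Tuple szt) t by rewrite perm_sort.
exists s => i j ij.
have nthE (i0 : 'I_k) : nth (g i) (sort leo t) i0 = g (s i0).
  by rewrite -[sort leo t]/(tval (Tuple szt)) sE nth_mktuple tnth_mktuple.
rewrite -!nthE ltn_neqAle; apply/andP; split.
  by rewrite !nthE (inj_eq val_inj) (inj_eq g_inj) (inj_eq perm_inj) neq_ltn ij.
have leo_tr : transitive leo by move=> a b c; apply: leq_trans.
have : sorted leo (sort leo t) by apply: sort_sorted => a b; apply: leq_total.
move=> /(sorted_ltn_nth leo_tr (g i)) h; apply: h => //.
  by rewrite inE (eqP szt).
by rewrite inE (eqP szt).
Qed.

(** Two matrices are compared through the common divisors of their minors, since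
    these determine the greatest ones ([is_gcd_eq]). *)
Definition common_divisor_of_minors k m n (c : R) (A : 'M[R]_(m, n)) :=
  forall x, is_minor k A x -> divides c x.

(** Repeated columns give a zero determinant and a permutation of the columns
    multiplies it by its sign, so increasing column choices suffice. *)
Lemma common_divisor_any_columns k m n (c : R) (A : 'M[R]_(m, n))
    (f : 'I_k -> 'I_m) (g : 'I_k -> 'I_n) :
    common_divisor_of_minors k c A -> {homo f : i j / (i < j)%N} ->
  divides c (\det (mxsub f g A : 'M_k)).
Proof.
move=> cA f_incr; have [/injectiveP g_inj|] := boolP (injectiveb g).
  have [s gs_incr] := increasing_rearrangement g_inj.
  have -> : mxsub f g A = mxsub f (g \o s) A *m perm_mx s.
    rewrite -[s in perm_mx s]invgK -col_permE; apply/matrixP=> i j.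
    by rewrite !mxE /= permKV.
  rewrite det_mulmx mulrC; apply/divides_mull/cA.
  by exists f, (g \o s).
case/injectivePn=> i [j ij gij]; rewrite -det_tr.
rewrite (@determinant_alternate _ _ _ i j) //; first exact: divides0.
by move=> k'; rewrite !mxE gij.
Qed.

(** Minors of the product are combinations of minors of the left factor with the
    same rows. *)
Lemma common_divisor_mulmxr k m n n' (c : R) (A : 'M[R]_(m, n))
    (B : 'M[R]_(n, n')) :
  common_divisor_of_minors k c A -> common_divisor_of_minors k c (A *m B).
Proof.
move=> cA _ [f [g [f_incr _ ->]]].
rewrite mxsub_mul det_mulmx_expand; apply: big_ind => [||h _].
- exact: divides0.
- exact: dividesD.
apply: divides_mull; rewrite -mxsub_comp.
exact: common_divisor_any_columns.
Qed.

Lemma common_divisor_diag_mulmx k m n (c : R) (d : 'rV_m) (A : 'M[R]_(m, n)) :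
  common_divisor_of_minors k c A -> common_divisor_of_minors k c (diag_mx d *m A).
Proof.
move=> cA _ [f [g [f_incr g_incr ->]]].
have -> : mxsub f g (diag_mx d *m A) =
          diag_mx (colsub f d) *m mxsub f g A.
  by apply/matrixP=> i j; rewrite !mul_diag_mx !mxE.
by rewrite det_mulmx; apply: divides_mull; apply: cA; exists f, g.
Qed.

Lemma common_divisor_scale k m n (c : R) (A B : 'M[R]_(m, n)) (u : 'I_m -> R)
    (v : 'I_n -> R) : (forall i j, A i j = u i * B i j * v j) ->
  common_divisor_of_minors k c B -> common_divisor_of_minors k c A.
Proof.
move=> AE cB.
have -> : A = diag_mx (\row_i u i) *m (B *m diag_mx (\row_j v j)).
  by apply/matrixP=> i j; rewrite mul_diag_mx mul_mx_diag !mxE AE mulrA.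
exact/common_divisor_diag_mulmx/common_divisor_mulmxr.
Qed.

(** This absorbs the change of fundamental domain, which multiplies rows and
    columns by group elements. *)
Lemma common_divisor_unit_scale k m n (c : R) (A B : 'M[R]_(m, n))
    (u : 'I_m -> R) (v : 'I_n -> R) :
    (forall i, is_unit (u i)) -> (forall j, is_unit (v j)) ->
    (forall i j, A i j = u i * B i j * v j) ->
  common_divisor_of_minors k c A <-> common_divisor_of_minors k c B.
Proof.
move=> /choice[u' uu'] /choice[v' vv'] AE.
split; last exact: common_divisor_scale AE.
apply: (common_divisor_scale (u := u') (v := v')) => i j; rewrite AE.
transitivity ((u i * u' i) * B i j * (v j * v' j)); last by ring.
by rewrite uu' vv' mul1r mulr1.
Qed.

End Minors.

Section Gcds.
Local Open Scope ring_scope.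

(** The cancellation in [b = b * (v * u)] needs a domain. *)
Lemma is_gcd_unique (R : comNzRingType) (S : R -> Prop) (a b : R) :
    (forall x y : R, x * y = 0 -> x = 0 \/ y = 0) ->
  is_gcd S a -> is_gcd S b -> equal_up_to_unit a b.
Proof.
move=> R_dom [aS amax] [bS bmax].
have [u bE] := bmax _ aS; have [v aE] := amax _ bS.
have /R_dom[b0|] : b * (1 - v * u) = 0.
  by rewrite mulrBr mulr1 mulrA -aE -bE subrr.
  by exists 1; [exists 1; rewrite mul1r | rewrite aE b0 mul0r mulr0].
by move/subr0_eq=> vu1; exists v; [exists u | rewrite mulrC].
Qed.

Lemma is_gcd_associate (R : comNzRingType) (S : R -> Prop) (a b : R) :
  equal_up_to_unit a b -> is_gcd S b -> is_gcd S a.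
Proof.
move=> [u [v uv1] ->] [bS bmax]; split=> [x /bS[c ->]|c /bmax].
  by exists (v * c); rewrite mulrACA uv1 mul1r.
exact: divides_mull.
Qed.

Lemma is_gcd_eq (R : comNzRingType) (S S' : R -> Prop) (d : R) :
    (forall c, (forall x, S x -> divides c x) <-> (forall x, S' x -> divides c x)) ->
  is_gcd S d <-> is_gcd S' d.
Proof.
move=> SS'; split=> -[dS dmax]; (split; first exact/SS') => c cS;
  by apply/dmax/SS'.
Qed.

Lemma is_gcd_minors_map (R R' : comNzRingType) (f : {rmorphism R -> R'})
    (g : {rmorphism R' -> R}) k m n (A : 'M[R]_(m, n)) d :
    cancel f g -> cancel g f ->
  is_gcd (is_minor k A) d -> is_gcd (is_minor k (map_mx f A)) (f d).
Proof.
move=> fK gK [dA dmax]; split.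
  move=> _ [h1 [h2 [h1_incr h2_incr ->]]]; rewrite -map_mxsub det_map_mx.
  have [c ->] : divides d (\det (mxsub h1 h2 A : 'M_k)).
    by apply: dA; exists h1, h2.
  by exists (f c); rewrite rmorphM.
move=> c cA; have [x dE] : divides (g c) d.
  apply: dmax => _ [h1 [h2 [h1_incr h2_incr ->]]].
  have [x xE] : divides c (\det (mxsub h1 h2 (map_mx f A) : 'M_k)).
    by apply: cA; exists h1, h2.
  exists (g x); rewrite -rmorphM -xE -map_mxsub det_map_mx.
  by rewrite fK.
by exists (f x); rewrite dE rmorphM gK.
Qed.
End Gcds.

(** * Permutations of the vertices of a tetrahedron *)

Section Perm4.

Lemma ord4P (i : 'I_4) : [\/ i = v0, i = v1, i = v2 | i = v3].
Proof.
by case: i => [[|[|[|[|//]]]] ilt]; [constructor 1|constructor 2|constructor 3|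
   constructor 4]; apply: val_inj.
Qed.

Lemma eq_perm4 (s s' : 'S_4) :
  s v0 = s' v0 -> s v1 = s' v1 -> s v2 = s' v2 -> s = s'.
Proof.
move=> e0 e1 e2; apply/permP=> i; case: (ord4P i) => -> //.
have [j sj] : exists j, s' j = s v3 by exists (s'^-1 (s v3))%g; rewrite permKV.
case: (ord4P j) sj => -> //; rewrite -?e0 -?e1 -?e2 => /perm_inj //.
Qed.

(** An even flag is thus the same thing as an oriented edge of a
    tetrahedron. *)
Lemma even_perm4_eq (s s' : 'S_4) : odd_perm s = odd_perm s' ->
  s v0 = s' v0 -> s v1 = s' v1 -> s = s'.
Proof.
move=> par e0 e1; have [j sj] : exists j, s' j = s v2.
  by exists (s'^-1 (s v2))%g; rewrite permKV.
case: (ord4P j) sj => -> e2; first by move: e2; rewrite -e0 => /perm_inj.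
- by move: e2; rewrite -e1 => /perm_inj.
- exact: eq_perm4.
have sE : s = (tperm v2 v3 * s')%g.
  by apply: eq_perm4; rewrite permM ?tpermL ?tpermD.
by move: par; rewrite sE odd_permM odd_tperm /=; case: odd_perm.
Qed.

Lemma exists_even_perm4 (i j : 'I_4) : i != j ->
  exists s : 'S_4, [/\ ~~ odd_perm s, s v0 = i & s v1 = j].
Proof.
move=> ij; pose s := (tperm v1 (tperm v0 i j) * tperm v0 i)%g.
have s1 : s v1 = j by rewrite permM tpermL tpermK.
have s0 : s v0 = i.
  rewrite permM [tperm v1 _ _]tpermD ?tpermL //.
  rewrite (canF_eq (tpermK _ _)) tpermL eq_sym //.
exists (if odd_perm s then tperm v2 v3 * s else s)%g.
case: ifPn => [os|//]; split; first by rewrite odd_permM os odd_tperm.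
  by rewrite permM [tperm v2 v3 _]tpermD.
by rewrite permM [tperm v2 v3 _]tpermD.
Qed.

(** The 3-cycle that turns the face opposite to [v2]. *)
Lemma even_3_cycle : {q : 'S_4 | odd_perm q = false &
  [/\ q v0 = v1, q v1 = v3, q v3 = v0 & q v2 = v2]}.
Proof.
exists (tperm v0 v1 * tperm v0 v3)%g; first by rewrite odd_permM !odd_tperm.
by split; rewrite permM; do 4 rewrite ?permE /=.
Qed.

Definition cyc : 'S_4 := s2val even_3_cycle.

Lemma odd_cyc : odd_perm cyc = false.
Proof. exact: s2valP even_3_cycle. Qed.

Lemma cycE : (cyc v0 = v1) * (cyc v1 = v3) * (cyc v3 = v0) * (cyc v2 = v2).
Proof. by case: (s2valP' even_3_cycle). Qed.

Lemma even_perm4_fix (q : 'S_4) : ~~ odd_perm q -> q v2 = v2 ->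
  [\/ q = 1%g, q = cyc | q = (cyc * cyc)%g].
Proof.
move=> eq q2.
have even1 : ~~ odd_perm (1 : 'S_4) by rewrite odd_perm1.
have evenc : ~~ odd_perm cyc by rewrite odd_cyc.
have evencc : ~~ odd_perm (cyc * cyc) by rewrite odd_permM (negPf evenc).
have n20 : q v0 != v2 by rewrite -q2 (inj_eq perm_inj).
have n21 : q v1 != v2 by rewrite -q2 (inj_eq perm_inj).
have n01 : q v0 != q v1 by rewrite (inj_eq perm_inj).
have not_tperm i j : i != j -> tperm i j v2 = v2 -> q v0 = tperm i j v0 ->
    q v1 = tperm i j v1 -> False.
  move=> ij t2 t0 t1; have qt : q = tperm i j by apply: eq_perm4; rewrite // q2.
  by move: eq; rewrite qt odd_tperm ij.
case: (ord4P (q v0)) n20 n01 => e0; rewrite e0 // => _.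
all: case: (ord4P (q v1)) n21 => e1; rewrite e1 // => _ _.
- by constructor 1; apply: even_perm4_eq; rewrite ?(negPf eq) ?(negPf even1) ?perm1.
- by case: (not_tperm v1 v3); rewrite // ?e0 ?e1 ?tpermL // tpermD.
- by case: (not_tperm v0 v1); rewrite // ?e0 ?e1 ?tpermL ?tpermR // tpermD.
- constructor 2; apply: even_perm4_eq; rewrite ?(negPf eq) ?(negPf evenc) //.
    by rewrite e0 cycE.
  by rewrite e1 cycE.
- constructor 3; apply: even_perm4_eq; rewrite ?(negPf eq) ?(negPf evencc) //.
    by rewrite e0 permM !cycE.
  by rewrite e1 permM !cycE.
- by case: (not_tperm v0 v3); rewrite // ?e0 ?e1 ?tpermL ?tpermR // tpermD.
Qed.

(** The even flags for which a given face is opposite to [v2] are obtained from one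
    of them by turning that face. *)
Lemma big_even_perm4 (A : zmodType) (F : 'S_4 -> A) (s : 'S_4) : ~~ odd_perm s ->
  (\sum_(q : 'S_4 | ~~ odd_perm q && (q v2 == s v2)) F q =
   F s + F (cyc * s)%g + F (cyc * cyc * s)%g)%R.
Proof.
move=> es; pose l := [:: s; cyc * s; cyc * cyc * s]%g.
have neq (a b : 'S_4) : a v0 != b v0 -> a != b.
  by move=> ab; apply: contraNneq ab => ->.
have Ul : uniq l.
  have n1 : s != (cyc * s)%g by apply: neq; rewrite !permM !cycE (inj_eq perm_inj).
  have n2 : s != (cyc * cyc * s)%g.
    by apply: neq; rewrite !permM !cycE (inj_eq perm_inj).
  have n3 : (cyc * s)%g != (cyc * cyc * s)%g.
    by apply: neq; rewrite !permM !cycE (inj_eq perm_inj).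
  by rewrite /= !inE negb_or n1 n2 n3.
transitivity (\sum_(q <- l) F q)%R; last by rewrite !big_cons big_nil /= addrA addr0.
rewrite big_uniq //=; apply: eq_bigl => q; rewrite !inE.
apply/andP/or3P => [[eq /eqP q2]|].
  have [] := @even_perm4_fix (q * s^-1)%g.
  - by rewrite odd_permM odd_permV (negPf eq) (negPf es).
  - by rewrite permM q2 permK.
  - by move/(canRL (mulgK _)); rewrite invgK mul1g => ->; constructor 1.
  - by move/(canRL (mulgK _)); rewrite invgK => ->; constructor 2.
  - by move/(canRL (mulgK _)); rewrite invgK => ->; constructor 3.
case=> /eqP->; first by rewrite es.
  by rewrite odd_permM odd_cyc permM cycE es.
by rewrite !odd_permM odd_cyc !permM !cycE es.
Qed.

End Perm4.

(** * Rotating around an edge *)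

Section Flags.
Variable V : transverse_taut.
Implicit Types (t : tet V) (s : 'S_4) (c d : flag V).
Local Notation rot := (@rotate_flag V).
Local Notation rev := (@reverse_flag V).

Lemma up_countP t s :
  (up t (s v0) + up t (s v1) + up t (s v2) + up t (s v3) = 2)%N.
Proof.
transitivity #|[set i | up t i]|; last exact: up_card.
rewrite -sum1_card big_mkcond (reindex_inj (@perm_inj _ s)) /=.
rewrite !big_ord_recl big_ord0 /= !inE addn0 !addnA.
have -> : v0 = ord0 by apply: val_inj.
have -> : v1 = lift ord0 ord0 by apply: val_inj.
have -> : v2 = lift ord0 (lift ord0 ord0) by apply: val_inj.
have -> : v3 = lift ord0 (lift ord0 (lift ord0 ord0)) by apply: val_inj.
by do 4 case: up.
Qed.

Definition above_edge c :=
  common_edge [set i | ~~ up c.1 i] (c.2 v0) (c.2 v1).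

Lemma common_edgeE s (A : {set 'I_4}) :
  common_edge A (s v0) (s v1) =
  [&& s v0 \notin A, s v1 \notin A, s v2 \in A & s v3 \in A].
Proof.
rewrite /common_edge (inj_eq perm_inj) /=; apply/eqP/idP => [->|].
  by rewrite !inE !(inj_eq perm_inj).
case/and4P=> s0 s1 s2 s3; apply/setP=> i; rewrite -(permKV s i).
by case: (ord4P (s^-1 i)%g) => ->; rewrite !inE ?(negPf s0) ?(negPf s1) ?s2 ?s3
  !(inj_eq perm_inj).
Qed.

(** If both faces at the edge are top faces, the two others are bottom faces,
    because there are exactly two top faces. *)
Lemma below_edgeE c : below_edge c = up c.1 (c.2 v2) && up c.1 (c.2 v3).
Proof.
rewrite [LHS]common_edgeE !inE; move: (up_countP c.1 c.2).
by do 4 case: up.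
Qed.

Lemma above_edgeE c : above_edge c = ~~ up c.1 (c.2 v2) && ~~ up c.1 (c.2 v3).
Proof.
rewrite [LHS]common_edgeE !inE; move: (up_countP c.1 c.2).
by do 4 case: up.
Qed.

Definition even_flag c := ~~ odd_perm c.2.

(** The same oriented edge, with the other direction of rotation. *)
Definition mirror_flag c : flag V := (c.1, (tperm v2 v3 * c.2)%g).

Lemma even_rot c : even_flag (rot c) = even_flag c.
Proof. by rewrite /even_flag !odd_permM odd_tperm glue_odd addbT /= negbK. Qed.

Lemma even_rev c : even_flag (rev c) = even_flag c.
Proof. by rewrite /even_flag !odd_permM !odd_tperm. Qed.

Lemma even_mirror c : even_flag (mirror_flag c) = ~~ even_flag c.
Proof. by rewrite /even_flag !odd_permM !odd_tperm. Qed.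

Lemma rot_v0 c : (rot c).2 v0 = glue c.1 (c.2 v3) (c.2 v0).
Proof. by rewrite !permM tpermD. Qed.

Lemma rot_v1 c : (rot c).2 v1 = glue c.1 (c.2 v3) (c.2 v1).
Proof. by rewrite !permM tpermD. Qed.

Lemma rot_v2 c : (rot c).2 v2 = glue c.1 (c.2 v3) (c.2 v3).
Proof. by rewrite !permM tpermL. Qed.

Lemma rev_v0 c : (rev c).2 v0 = c.2 v1.
Proof. by rewrite !permM tpermL tpermD. Qed.

Lemma rev_v1 c : (rev c).2 v1 = c.2 v0.
Proof. by rewrite !permM tpermR tpermD. Qed.

Lemma rev_v2 c : (rev c).2 v2 = c.2 v3.
Proof. by rewrite !permM [tperm v0 v1 _]tpermD // tpermL. Qed.

Lemma rev_v3 c : (rev c).2 v3 = c.2 v2.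
Proof. by rewrite !permM [tperm v0 v1 _]tpermD // tpermR. Qed.

Lemma mirror_v3 c : (mirror_flag c).2 v3 = c.2 v2.
Proof. by rewrite permM tpermR. Qed.

Lemma reverse_flagK : involutive rev.
Proof.
case=> t s; congr pair; rewrite /= mulgA -[RHS]mul1g; congr (_ * _)%g.
by apply: eq_perm4; rewrite perm1 !permM; do 4 rewrite ?permE /=.
Qed.

Lemma mirrorK : involutive mirror_flag.
Proof. by case=> t s; congr pair; rewrite /= mulgA tperm2 mul1g. Qed.

(** Turning a flag around conjugates the rotation to its inverse.  This form
    avoids naming the inverse. *)
Lemma rot_rev_rot c : rot (rev (rot c)) = rev c.
Proof.
rewrite /rotate_flag rev_v3 rot_v2 /= adjK glueK.
congr pair; rewrite !mulgA mulgK; congr (_ * _)%g.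
by apply: eq_perm4; rewrite !permM; do 4 rewrite ?permE /=.
Qed.

Lemma rot_mirror_rot c : rot (mirror_flag (rot c)) = mirror_flag c.
Proof.
rewrite /rotate_flag mirror_v3 rot_v2 /= adjK glueK.
by congr pair; rewrite !mulgA mulgK tperm2 mul1g.
Qed.

Lemma rotate_flag_inj : injective rot.
Proof.
by move=> c d cd; rewrite -(reverse_flagK c) -(rot_rev_rot c) cd rot_rev_rot reverse_flagK.
Qed.

Lemma up_rot c : up (rot c).1 ((rot c).2 v2) = ~~ goes_up c.
Proof. by rewrite rot_v2 up_glue. Qed.

Lemma tri_of_glue t i : tri_of (adj t i) (glue t i i) = tri_of t i.
Proof. by apply/esym/tri_of_eq; right. Qed.

Lemma tri_of_rot c : tri_of (rot c).1 ((rot c).2 v2) = across c.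
Proof. by rewrite rot_v2 tri_of_glue. Qed.

Lemma below_edge_rot c : below_edge (rot c) = ~~ goes_up c && goes_up (rot c).
Proof. by rewrite below_edgeE up_rot. Qed.

Lemma above_edge_rot c : above_edge (rot c) = goes_up c && ~~ goes_up (rot c).
Proof. by rewrite above_edgeE up_rot negbK. Qed.

Lemma below_edge_rev c : below_edge (rev c) = below_edge c.
Proof. by rewrite !below_edgeE rev_v2 rev_v3 andbC. Qed.

Lemma above_edge_rev c : above_edge (rev c) = above_edge c.
Proof. by rewrite !above_edgeE rev_v2 rev_v3 andbC. Qed.

Lemma goes_up_rev_rot c : goes_up (rev (rot c)) = ~~ goes_up c.
Proof. by rewrite /goes_up rev_v3 up_rot. Qed.

Lemma across_rev_rot c : across (rev (rot c)) = across c.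
Proof. by rewrite /across rev_v3 tri_of_rot. Qed.

Lemma goes_up_mirror_rot c : goes_up (mirror_flag (rot c)) = ~~ goes_up c.
Proof. by rewrite /goes_up mirror_v3 up_rot. Qed.

Lemma across_mirror_rot c : across (mirror_flag (rot c)) = across c.
Proof. by rewrite /across mirror_v3 tri_of_rot. Qed.

Lemma edg_ofC t i j : i != j -> edg_of t i j = edg_of t j i.
Proof.
move=> ij; apply/edg_of_eq => //; first by rewrite eq_sym.
apply: connect1.
by rewrite /edge_step eqxx.
Qed.

Lemma edg_of_glue t i j k : i != j -> k != i -> k != j ->
  edg_of (adj t k) (glue t k i) (glue t k j) = edg_of t i j.
Proof.
move=> ij ki kj; apply/esym/edg_of_eq; rewrite ?(inj_eq perm_inj) //.
apply: connect1; apply/orP; right; apply/existsP; exists k.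
by rewrite ki kj eqxx.
Qed.

Lemma flag_edge_rot c : flag_edge (rot c) = flag_edge c.
Proof.
rewrite /flag_edge rot_v0 rot_v1.
by apply: edg_of_glue; rewrite (inj_eq perm_inj).
Qed.

Lemma flag_edge_rev c : flag_edge (rev c) = flag_edge c.
Proof. by rewrite /flag_edge rev_v0 rev_v1 edg_ofC // (inj_eq perm_inj). Qed.

Lemma flag_edge_mirror c : flag_edge (mirror_flag c) = flag_edge c.
Proof. by rewrite /flag_edge /= !permM !tpermD. Qed.

Lemma fconnect_rot_sym : connect_sym (frel rot).
Proof. exact: fconnect_sym rotate_flag_inj. Qed.

(** Used for both [reverse_flag] and [mirror_flag], each of which conjugates the
    rotation to its inverse. *)
Lemma fconnect_turn (turn : flag V -> flag V) c d :
    (forall b, rot (turn (rot b)) = turn b) ->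
  fconnect rot c d -> fconnect rot (turn c) (turn d).
Proof.
move=> turn_rot /iter_findex <-; elim: (findex _ _ _) => //= n IHn.
rewrite (connect_trans IHn) // fconnect_rot_sym connect1 //=.
by rewrite turn_rot.
Qed.

Lemma fconnect_rev c d : fconnect rot c d -> fconnect rot (rev c) (rev d).
Proof. exact/fconnect_turn/rot_rev_rot. Qed.

Lemma flag_edge_fconnect c d : fconnect rot c d -> flag_edge d = flag_edge c.
Proof.
move=> /iter_findex <-; elim: (findex _ _ _) => //= n <-.
exact: flag_edge_rot.
Qed.

Lemma even_fconnect c d : fconnect rot c d -> even_flag d = even_flag c.
Proof.
move=> /iter_findex <-; elim: (findex _ _ _) => //= n <-.
exact: even_rot.
Qed.

Lemma rev_neq c : rev c != c.
Proof.
apply/eqP => /(congr1 (fun d : flag V => d.2 v0)) /eqP.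
by rewrite rev_v0 (inj_eq perm_inj).
Qed.

Lemma rev_neq_rot c : rev c != rot c.
Proof.
apply/eqP => e; apply: (@glue_neq _ c.1 (c.2 v3)); rewrite -rot_v2 -e rev_v2.
by congr pair; have /= <- := congr1 fst e.
Qed.

(** No edge is glued to itself with its ends exchanged.  If [n] steps of rotation
    reverse [c], then [n - 2] steps reverse [rot c], as the reversal conjugates
    the rotation to its inverse.  This descends to a flag that equals its
    reversal, or to a face glued to itself. *)
Lemma iter_rot_neq_rev n c : iter n rot c != rev c.
Proof.
have [m] := ubnP n; elim: m => // m IHm in n c *.
case: n => [|[|n]] /ltnSE lnm; first by rewrite eq_sym rev_neq.
  by rewrite eq_sym rev_neq_rot.
apply/eqP => /=; rewrite -(rot_rev_rot c) -!iterS iterSr iterS => /rotate_flag_inj /eqP.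
by rewrite (negPf (IHm _ _ _)) // ltnW.
Qed.

Lemma rev_notin_orbit c d : fconnect rot c d -> ~~ fconnect rot c (rev d).
Proof.
move=> cd; apply/negP => cd'; have /iter_findex/eqP : fconnect rot d (rev d).
  by rewrite (connect_trans _ cd') // fconnect_rot_sym.
by rewrite (negPf (iter_rot_neq_rev _ _)).
Qed.

(** The gluing steps that generate the identification of edges lift to flags:
    exchanging the ends is the reversal, and crossing one of the two faces at the
    edge is a rotation step forwards or backwards. *)
Lemma even_flag_edge_eq c d : even_flag c -> even_flag d ->
    flag_edge c = flag_edge d ->
  fconnect rot c d \/ fconnect rot (rev c) d.
Proof.
move=> ec ed /edg_of_eq; rewrite !(inj_eq perm_inj) => /(_ isT isT).
case/connectP=> p; set x := (c.1, _, _) => pth.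
have : exists b, [/\ even_flag b, fconnect rot c b \/ fconnect rot (rev c) b
    & x = (b.1, b.2 v0, b.2 v1)] by exists c; split=> //; left; exact: connect0.
elim: p x pth => [|y p IHp] x /=.
  move=> _ [b [eb cb ->]] [d1 d0 d1']; suff <- : b = d by [].
  case: b d ed eb {cb} d1 d0 d1' => [t s] [t' s'] /= es' es -> e0 e1.
  by congr pair; apply: even_perm4_eq; rewrite // (negPf es) (negPf es').
case/andP=> xy pth [b [eb cb xE]]; apply: IHp => //.
move: xy; rewrite xE /= => /orP[/eqP->|/existsP[k /and3P[k0 k1 /eqP->]]].
  exists (rev b); split; rewrite ?even_rev ?rev_v0 ?rev_v1 //.
  case: cb => /fconnect_rev cb; first by right.
  by left; rewrite -(reverse_flagK c).
have [j kj] : exists j, b.2 j = k by exists (b.2^-1 k)%g; rewrite permKV.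
case: (ord4P j) kj k0 k1 => -> <-; rewrite ?eqxx // => _ _.
  exists (rev (rot (rev b))); split.
  - by rewrite even_rev even_rot even_rev.
  - have bb : fconnect rot b (rev (rot (rev b))).
      by rewrite fconnect_rot_sym connect1 //= rot_rev_rot reverse_flagK.
    by case: cb => cb; [left|right]; apply: connect_trans bb.
  - rewrite -[(rev (rot (rev b))).1]/(adj b.1 ((rev b).2 v3)).
    by rewrite rev_v0 rev_v1 rot_v0 rot_v1 rev_v0 rev_v1 rev_v3.
exists (rot b); split; first by rewrite even_rot.
  by case: cb => cb; [left|right]; apply: connect_trans (fconnect1 _ _).
by rewrite rot_v0 rot_v1.
Qed.

Definition angle_pi (x : tet V * 'I_4 * 'I_4) : bool :=
  let: (t, i, j) := x in
  common_edge [set k | up t k] i j || common_edge [set k | ~~ up t k] i j.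

Lemma card_angle_pi (e : edg V) :
  #|[set x : tet V * 'I_4 * 'I_4 |
      [&& (x.1.2 < x.2)%N, edg_of x.1.1 x.1.2 x.2 == e & angle_pi x]]| = 2%N.
Proof.
rewrite -[RHS](angle_sum e) -sum1_card.
rewrite pair_big /= pair_big_dep /= big_mkcond [RHS]big_mkcond /=.
apply: eq_bigr => -[[t i] j] _; rewrite !inE /= /angle_pi.
by case: ltnP; case: eqP; case: common_edge; case: common_edge.
Qed.

Definition flag_pair c : tet V * 'I_4 * 'I_4 :=
  if (c.2 v0 < c.2 v1)%N then (c.1, c.2 v0, c.2 v1) else (c.1, c.2 v1, c.2 v0).

(** Within one orbit [flag_pair] is therefore injective, by [rev_notin_orbit];
    this is how flags are counted by [card_angle_pi]. *)
Lemma flag_pair_eq c d : even_flag c -> even_flag d ->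
  flag_pair c = flag_pair d -> c = d \/ c = rev d.
Proof.
have aux a b : even_flag a -> even_flag b -> a.1 = b.1 -> a.2 v0 = b.2 v0 ->
    a.2 v1 = b.2 v1 -> a = b.
  case: a b => [t s] [t' s'] es es' /= -> e0 e1; congr pair.
  by apply: even_perm4_eq; rewrite // (negPf es) (negPf es').
move=> ec ed; rewrite /flag_pair.
case: ifP => _; case: ifP => _ [c1 c2 c3]; try by left; apply: aux.
  by right; apply: aux; rewrite ?even_rev ?rev_v0 ?rev_v1.
by right; apply: aux; rewrite ?even_rev ?rev_v0 ?rev_v1.
Qed.

Lemma common_edgeC (A : {set 'I_4}) i j : common_edge A i j = common_edge A j i.
Proof. by rewrite /common_edge eq_sym setUC. Qed.

Lemma flag_pairP c : below_edge c || above_edge c ->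
  flag_pair c \in [set x : tet V * 'I_4 * 'I_4 |
      [&& (x.1.2 < x.2)%N, edg_of x.1.1 x.1.2 x.2 == flag_edge c & angle_pi x]].
Proof.
move=> pic; rewrite inE; case: (ltngtP (c.2 v0) (c.2 v1)) => [lt01|lt10|/val_inj/eqP].
- by rewrite /flag_pair lt01 /= lt01 eqxx.
- have nlt : (c.2 v0 < c.2 v1)%N = false by rewrite ltnNge (ltnW lt10).
  rewrite /flag_pair nlt /= lt10 edg_ofC ?(inj_eq perm_inj) //.
  by rewrite eqxx !(common_edgeC _ (c.2 v1)).
- by rewrite (inj_eq perm_inj).
Qed.

(** Three flags of one orbit with angle pi would give the edge an angle sum of at
    least 3 pi. *)
Lemma no_three_pi c c1 c2 c3 : even_flag c ->
    fconnect rot c c1 -> fconnect rot c c2 -> fconnect rot c c3 ->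
    uniq [:: c1; c2; c3] -> ~~ all (fun d => below_edge d || above_edge d)
  [:: c1; c2; c3].
Proof.
move=> ec cc1 cc2 cc3 Uc; apply/negP => pi3.
pose e := flag_edge c; have := card_angle_pi e.
set X := [set x | _] => cardX.
have sub : {subset map flag_pair [:: c1; c2; c3] <= X}.
  move=> _ /mapP[d dc ->]; have /flag_pairP := allP pi3 d dc.
  suff -> : flag_edge d = e by [].
  by apply: flag_edge_fconnect; move: dc; rewrite !inE => /or3P[]/eqP->.
have Upair : uniq (map flag_pair [:: c1; c2; c3]).
  rewrite map_inj_in_uniq // => a b ain bin ab.
  have [ca cb] : fconnect rot c a /\ fconnect rot c b.
    by move: ain bin; rewrite !inE => /or3P[]/eqP-> /or3P[]/eqP->.
  have [//|aE] : a = b \/ a = rev b.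
    by apply: flag_pair_eq; rewrite // (even_fconnect ca, even_fconnect cb).
  by move: ca; rewrite aE (negPf (rev_notin_orbit cb)).
have := subset_leq_card (introT subsetP sub).
by rewrite cardX (card_uniqP Upair).
Qed.

Lemma exists_down c : below_edge c ->
  exists2 n, (0 < n < order rot c)%N & ~~ goes_up (iter n rot c).
Proof.
move=> bc; have o0 := orderSpred rot c; exists (order rot c).-1; last first.
  have := bc; rewrite -[in below_edge c](iter_order rotate_flag_inj c) -o0 iterS.
  by rewrite below_edge_rot => /andP[].
rewrite ltn_predL order_gt0 andbT lt0n; apply/eqP => o1.
move: (iter_order rotate_flag_inj c) bc; rewrite -o0 o1 /= => rc.
by rewrite -[in below_edge c]rc below_edge_rot rc andNb.
Qed.

(** The rotation leaves [c] upwards and comes back to it downwards, so it turns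
    over in between. *)
Lemma exists_above c : below_edge c -> exists2 a, fconnect rot c a & above_edge a.
Proof.
move=> bc; have [n _ dn] := exists_down bc.
have uc : goes_up c by move: bc; rewrite below_edgeE => /andP[].
elim: n dn => [|n IHn] /= dn; first by rewrite uc in dn.
have [un|] := boolP (goes_up (iter n rot c)); last exact: IHn.
exists (rot (iter n rot c)); last by rewrite above_edge_rot un.
exact: (fconnect_iter rot n.+1 c).
Qed.

Lemma below_not_above c : below_edge c -> ~~ above_edge c.
Proof. by rewrite below_edgeE above_edgeE => /andP[-> ->]. Qed.

(** A second flag below the edge, together with [c] and the flag above the edge
    provided by [exists_above], would contradict [no_three_pi]. *)
Lemma below_unique c d : even_flag c -> below_edge c -> below_edge d ->
  fconnect rot c d -> d = c.
Proof.
move=> ec bc bd cd; apply/eqP/negPn/negP => dc.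
have [a ca aa] := exists_above bc.
have ab : forall b, below_edge b -> b != a.
  by move=> b bb; apply: contraNneq (below_not_above bb) => ->.
have U : uniq [:: c; d; a] by rewrite /= !inE negb_or eq_sym dc !ab.
by have := no_three_pi ec (connect0 _ _) cd ca U; rewrite /= bc bd aa orbT.
Qed.

(** The angle sum provides a flag with angle pi in the orbit.  If none were below
    the edge, then one above it would keep going down for ever. *)
Lemma exists_below c : even_flag c -> exists2 d, fconnect rot c d & below_edge d.
Proof.
move=> ec; apply: contrapT => nobelow.
have {}nobelow d : fconnect rot c d -> ~~ below_edge d.
  by move=> cd; apply/negP => bd; apply: nobelow; exists d.
have [x] : exists x, x \in [set x : tet V * 'I_4 * 'I_4 |
      [&& (x.1.2 < x.2)%N, edg_of x.1.1 x.1.2 x.2 == flag_edge c & angle_pi x]].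
  by apply/set0Pn; rewrite -card_gt0 card_angle_pi.
case: x => [[t i] j]; rewrite inE /= => /and3P[ij /eqP eE pix].
have neq_ij : i != j by rewrite neq_ltn ij.
have [s [es s0 s1]] := exists_even_perm4 neq_ij.
pose d : flag V := (t, s).
have [a [ea ca aa]] : exists a, [/\ even_flag a, fconnect rot c a & above_edge a].
  have ed : even_flag d by [].
  have dE : flag_edge c = flag_edge d by rewrite /flag_edge /= s0 s1.
  have : below_edge d || above_edge d by rewrite /below_edge /above_edge /= s0 s1.
  case: (even_flag_edge_eq ec ed dE) => cd.
    by rewrite (negPf (nobelow _ cd)) /= => ad; exists d.
  have {}cd : fconnect rot c (rev d) by rewrite -(reverse_flagK c) fconnect_rev.
  have := nobelow _ cd; rewrite below_edge_rev => /negPf-> /= ad.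
  by exists (rev d); rewrite even_rev above_edge_rev.
have alldown n : ~~ goes_up (iter n rot a).
  elim: n => [|n IHn] /=; first by move: aa; rewrite above_edgeE => /andP[].
  apply/negP => un; have := nobelow (iter n.+1 rot a).
  by rewrite /= below_edge_rot IHn un (connect_trans ca (fconnect_iter _ n.+1 _)) => /(_ isT).
move: aa; rewrite -(iter_order rotate_flag_inj a) -(orderSpred rot a) /= above_edge_rot.
by rewrite (negPf (alldown _)).
Qed.

End Flags.

(** * The two sides of an edge *)

Section Orbits.
Variable V : transverse_taut.
Implicit Types (t : tet V) (s : 'S_4) (c d : flag V) (f : tri V).
Local Notation rot := (@rotate_flag V).
Local Notation rev := (@reverse_flag V).

Definition up_part c : seq (flag V) :=
  take (find (fun d => ~~ goes_up d) (orbit rot c)) (orbit rot c).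

(** After the first descent the rotation cannot go up again before it is back at
    [c], since turning over from down to up happens only below the edge. *)
Lemma up_part_filter c : even_flag c -> below_edge c ->
  up_part c = [seq d <- orbit rot c | goes_up d].
Proof.
move=> ec bc; rewrite /up_part; set p := orbit rot c; set k := find _ p.
have sp : size p = order rot c by rewrite size_orbit.
have pE i : (i < order rot c)%N -> nth c p i = iter i rot c.
  by move=> io; rewrite nth_traject.
have k_p : (k < size p)%N.
  rewrite -has_find; have [n /andP[_ no] dn] := exists_down bc.
  by apply/hasP; exists (iter n rot c); rewrite // -fconnect_orbit fconnect_iter.
have dk : ~~ goes_up (iter k rot c).
  rewrite -pE -?sp //.
  by apply: (@nth_find _ c (fun d => ~~ goes_up d)); rewrite has_find.
have down i : (k <= i < order rot c)%N -> ~~ goes_up (iter i rot c).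
  elim: i => [|i IHi]; first by rewrite leqn0 => /andP[/eqP k0 _]; move: dk; rewrite k0.
  rewrite leq_eqVlt => /andP[/predU1P[<- //|ki io]].
  have {}IHi := IHi (introT andP (conj ki (ltnW io))).
  apply/negP => ui; have : iter i.+1 rot c = c.
    by apply: below_unique (fconnect_iter _ _ _); rewrite //= below_edge_rot IHi.
  move/(congr1 (findex rot c)); rewrite findex_iter // -[X in findex rot c X]/(iter 0 rot c).
  by rewrite findex_iter ?order_gt0.
rewrite -[in RHS](cat_take_drop k p) filter_cat.
rewrite (_ : filter _ (drop k p) = [::]) ?cats0.
  apply/esym/all_filterP/(all_nthP c) => i; rewrite size_takel; last exact: ltnW.
  move=> ik; rewrite nth_take //; have := before_find c ik.
  by move/negbFE.
rewrite -(filter_pred0 (drop k p)); apply: eq_in_filter => d.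
case/(nthP c) => i; rewrite size_drop sp ltn_subRL => kio <-.
by rewrite nth_drop pE //; apply/negbTE/down; rewrite leq_addr.
Qed.

Lemma side_filter c : even_flag c -> below_edge c ->
  side c = [seq across d | d <- orbit rot c & goes_up d].
Proof. by move=> ec bc; rewrite -up_part_filter. Qed.

End Orbits.

(** * Boundaries in the dual 2-complex *)

Section Cellular.
Local Open Scope ring_scope.
Variable V : transverse_taut.
Implicit Types (t : tet V) (s : 'S_4) (c d : flag V) (f : tri V).
Local Notation rot := (@rotate_flag V).
Local Notation rev := (@reverse_flag V).

Lemma big_orbit (A : zmodType) (F : flag V -> A) c (P : pred (flag V)) :
  \sum_(d <- orbit rot c | P d) F d = \sum_(d | fconnect rot c d && P d) F d.
Proof.
rewrite big_mkcondr /= [LHS]big_mkcond (big_uniq _ (orbit_uniq _ _)) /=.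
by apply: eq_bigl => d; rewrite fconnect_orbit.
Qed.

Definition flag_sign d : int := if goes_up d then 1 else -1.

Lemma bdry2E c f :
  bdry2 c f = \sum_(d | fconnect rot c d && (across d == f)) flag_sign d.
Proof. by rewrite ffunE big_orbit. Qed.

(** The reindexing of the orbit of [turn c] by the orbit of [c]: [turn (rot d)]
    crosses the same triangle as [d], in the opposite direction. *)
Lemma fconnect_turnE (turn : flag V -> flag V) c d :
    (forall b, rot (turn (rot b)) = turn b) -> involutive turn ->
  fconnect rot (turn c) (turn (rot d)) = fconnect rot c d.
Proof.
move=> turn_rot turnK; apply/idP/idP => [|cd].
  move/(fconnect_turn turn_rot); rewrite !turnK => /connect_trans; apply.
  by rewrite fconnect_rot_sym fconnect1.
apply: fconnect_turn => //; apply: connect_trans cd _; exact: fconnect1.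
Qed.

Lemma bdry2_turn (turn : flag V -> flag V) c :
    (forall b, rot (turn (rot b)) = turn b) -> involutive turn ->
    (forall b, goes_up (turn (rot b)) = ~~ goes_up b) ->
    (forall b, across (turn (rot b)) = across b) ->
  bdry2 (turn c) = - bdry2 c.
Proof.
move=> turn_rot turnK turn_up turn_across; apply/ffunP=> f.
rewrite [RHS]ffunE !bdry2E -sumrN.
rewrite (reindex_inj (inj_comp (inv_inj turnK) (@rotate_flag_inj V))) /=.
apply: eq_big => [d|d _]; first by rewrite fconnect_turnE // turn_across.
by rewrite /flag_sign turn_up; case: goes_up; rewrite ?opprK.
Qed.

Lemma bdry2_rev c : bdry2 (rev c) = - bdry2 c.
Proof.
apply: bdry2_turn; [exact: rot_rev_rot|exact: reverse_flagK|exact: goes_up_rev_rot|].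
exact: across_rev_rot.
Qed.

Lemma bdry2_mirror c : bdry2 (mirror_flag c) = - bdry2 c.
Proof.
apply: bdry2_turn; [exact: rot_mirror_rot|exact: mirrorK|
  exact: goes_up_mirror_rot|exact: across_mirror_rot].
Qed.

Lemma bdry2_fconnect c d : fconnect rot c d -> bdry2 d = bdry2 c.
Proof.
move=> cd; apply/ffunP=> f; rewrite !bdry2E; apply: eq_bigl => b.
by rewrite (same_connect (@fconnect_rot_sym V) cd).
Qed.

(** All flags of an edge are obtained from one of them by rotation, reversal and
    mirroring, each of which preserves the boundary up to sign. *)
Lemma bdry2_span (R : edg V -> flag V) c : (forall e, base_flag e (R e)) ->
  exists a : int, bdry2 c = bdry2 (R (flag_edge c)) *~ a.
Proof.
move=> R_base; wlog ec : c / even_flag c => [even_case|].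
  have [|oc] := boolP (even_flag c); first exact: even_case.
  have [|a] := even_case (mirror_flag c); first by rewrite even_mirror.
  rewrite flag_edge_mirror bdry2_mirror => cE; exists (- a).
  by rewrite mulrNz -cE opprK.
have /and3P[eR /eqP RE _] := R_base (flag_edge c).
case: (even_flag_edge_eq eR ec RE) => /bdry2_fconnect ->; first by exists 1.
by exists (- 1); rewrite bdry2_rev.
Qed.

(** The right-hand triangles are crossed upwards by the rotation, the left-hand
    ones downwards. *)
Lemma branch_bdry2 c f : even_flag c -> below_edge c ->
  bdry2 c f = (count_mem f (side c))%:Z - (count_mem f (side (rev c)))%:Z.
Proof.
move=> ec bc.
have countE b : even_flag b -> below_edge b -> (count_mem f (side b))%:Z =
    \sum_(d | fconnect rot b d && (goes_up d && (across d == f))) 1.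
  move=> eb bb; rewrite side_filter // -big_orbit count_map count_filter.
  rewrite -sum1_count -natz natr_sum; apply: eq_bigl => d /=.
  by rewrite andbC.
rewrite !countE ?even_rev ?below_edge_rev // bdry2E.
rewrite [X in _ - X](reindex_inj (inj_comp (inv_inj (@reverse_flagK V)) (@rotate_flag_inj V))) /=.
rewrite [X in _ = _ - X](eq_bigl (fun d =>
  (fconnect rot c d && (across d == f)) && ~~ goes_up d)); last first.
  move=> d; rewrite fconnect_turnE ?goes_up_rev_rot ?across_rev_rot.
  - by rewrite -andbA (andbC (across _ == _)).
  - exact: rot_rev_rot.
  - exact: reverse_flagK.
rewrite (bigID (@goes_up V)) /= -sumrN; congr (_ + _).
  apply: eq_big => d; last by case/andP=> _ du; rewrite /flag_sign du.
  by rewrite -andbA (andbC (across _ == _)).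
by apply: eq_bigr => d /andP[_ /negPf dd]; rewrite /flag_sign dd.
Qed.

Lemma bdry1_is_additive : zmod_morphism (@bdry1 V).
Proof.
move=> x y; apply/ffunP=> t; rewrite !ffunE.
rewrite (eq_bigr (fun i => x (tri_of t i) - y (tri_of t i))); last first.
  by move=> i _; rewrite !ffunE.
rewrite [X in _ - X = _](eq_bigr (fun i => x (tri_of t i) - y (tri_of t i))).
  by rewrite !sumrB opprD addrACA -opprD.
by move=> i _; rewrite !ffunE.
Qed.

HB.instance Definition _ := GRing.isZmodMorphism.Build (chain1 V)
  {ffun tet V -> int} (@bdry1 V) bdry1_is_additive.

Definition single f : chain1 V := [ffun g => (g == f)%:R].

Lemma sum_single t (P : pred 'I_4) t' i :
  \sum_(j | P j) single (tri_of t' i) (tri_of t j) =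
  ((t == t') && P i)%:R + ((t == adj t' i) && P (glue t' i i))%:R.
Proof.
rewrite big_mkcond (eq_bigr (fun j => ((t == t') && P j && (j == i))%:R +
   ((t == adj t' i) && P j && (j == glue t' i i))%:R)).
  have sum1 (b : bool) k : \sum_j (b && P j && (j == k))%:R = (b && P k)%:R :> int.
    rewrite (bigD1 k) //= eqxx andbT big1 ?addr0 // => j /negPf->.
    by rewrite andbF.
  by rewrite big_split /= !sum1.
move=> j _; rewrite ffunE.
have -> : (tri_of t j == tri_of t' i) =
          ((t == t') && (j == i)) || ((t == adj t' i) && (j == glue t' i i)).
  apply/eqP/orP => [/esym/tri_of_eq[]|[]] /=.
  - by case=> -> ->; left; rewrite !eqxx.
  - by case=> -> ->; right; rewrite !eqxx.
  - by case/andP=> /eqP-> /eqP->.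
  - by case/andP=> /eqP-> /eqP->; rewrite tri_of_glue.
case Pj: (P j); rewrite ?andbF ?andbT //=.
case A: ((t == t') && (j == i)); case B: (_ && _) => //.
case/andP: A B => /eqP-> /eqP-> /andP[/eqP e1 /eqP e2].
by case: (@glue_neq _ t' i); rewrite -e1 -e2.
Qed.

Definition tet_above t i := if up t i then adj t i else t.
Definition tet_below t i := if up t i then t else adj t i.

Lemma bdry1_single t i t' :
  bdry1 (single (tri_of t i)) t' =
  (t' == tet_above t i)%:R - (t' == tet_below t i)%:R.
Proof.
have at_tet (P : tet V -> bool) u : (t' == u) && P t' = (t' == u) && P u.
  by case: eqP => // ->.
rewrite ffunE !sum_single /=.
rewrite (at_tet (fun x => ~~ up x i)) (at_tet (fun x => ~~ up x (glue t i i))).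
rewrite (at_tet (fun x => up x i)) (at_tet (fun x => up x (glue t i i))).
rewrite up_glue /tet_above /tet_below.
by case: up; rewrite ?andbT ?andbF /= ?addr0 ?add0r.
Qed.

Lemma bdry2_single c :
  bdry2 c = \sum_(d | fconnect rot c d) single (across d) *~ flag_sign d.
Proof.
apply/ffunP=> f; rewrite bdry2E sum_ffunE big_mkcondr; apply: eq_bigr => d _.
rewrite ffunMzE ffunE eq_sym /flag_sign; case: eqP => // _; last by rewrite mul0rz.
by rewrite intz.
Qed.

(** Every step of a rotation contributes the difference of the tetrahedra at
    its two ends, so going once around an edge contributes nothing. *)
Lemma bdry1_bdry2 c : bdry1 (bdry2 c) = 0.
Proof.
rewrite bdry2_single raddf_sum /=; apply/ffunP=> t; rewrite sum_ffunE ffunE.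
rewrite (eq_bigr (fun d => (t == (rot d).1)%:R - (t == d.1)%:R)) => [|d _].
  apply/eqP; rewrite sumrB [X in _ - X](reindex_inj (@rotate_flag_inj V)) /=.
  rewrite subr_eq0; apply/eqP/eq_bigl => d; apply/esym.
  have /(same_connect1r (@fconnect_rot_sym V)) -> // : frel rot d (rot d).
  exact: eqxx.
rewrite raddfMz /= ffunMzE bdry1_single /tet_above /tet_below /flag_sign.
by rewrite /goes_up; case: up; rewrite ?mulrNz mulr1z ?opprB.
Qed.

End Cellular.

(** * Spanning trees *)

Section Trees.
Variable V : transverse_taut.
Implicit Types (t : tet V) (f : tri V) (Y : {set tri V}).

Lemma tree_adj_sym Y : symmetric (@tree_adj V Y).
Proof.
suff imp t t' : tree_adj Y t t' -> tree_adj Y t' t by move=> t t'; apply/idP/idP; apply: imp.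
case/existsP=> i /andP[iY /eqP<-]; apply/existsP; exists (glue t i i).
by rewrite tri_of_glue iY adjK /=.
Qed.

Lemma tree_connect_sym Y : connect_sym (@tree_adj V Y).
Proof. exact/sym_connect_sym/tree_adj_sym. Qed.

(** Propagation from the leaves of the tree, as an induction on the size of the
    component of [t] in the tree without the triangle [tri_of t i].  The components
    hanging at the other triangles of [t] are contained in it, and they miss
    [t]. *)
Lemma tree_induction Y (P : tri V -> Prop) : spanning_tree Y ->
    (forall f, f \notin Y -> P f) ->
    (forall t i, tri_of t i \in Y -> (forall j, j != i -> P (tri_of t j)) ->
       P (tri_of t i)) ->
  forall f, P f.
Proof.
move=> [_ acyclic] Pout Pstep f; have [t [i <-]] := tri_of_onto f.
pose branch t i := connect (tree_adj (Y :\ tri_of t i)) t.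
have [m] := ubnP #|branch t i|; elim: m => // m IHm in t i *; rewrite ltnS => le_m.
have [iY|] := boolP (tri_of t i \in Y); last exact: Pout.
apply: Pstep => // j ji; have [jY|] := boolP (tri_of t j \in Y); last exact: Pout.
have t_notin : ~~ branch (adj t j) (glue t j j) t.
  by rewrite /branch tri_of_glue tree_connect_sym acyclic.
have neq_ij : tri_of t i != tri_of t j.
  apply/eqP => /tri_of_eq[[/eqP]|[te _]]; first by rewrite (negPf ji).
  by have := acyclic t i iY; rewrite -te connect0.
rewrite -tri_of_glue; apply: IHm; apply: leq_trans le_m; apply: proper_card.
apply/properP; split; last first.
  by exists t; [exact: connect0 | exact: t_notin].
apply/subsetP=> x; rewrite -![x \in branch _ _]/(branch _ _ x) /branch tri_of_glue.
have tt' : connect (tree_adj (Y :\ tri_of t i)) t (adj t j).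
  apply: connect1; apply/existsP; exists j.
  by rewrite !inE eq_sym neq_ij jY /=.
have: connect (tree_adj (Y :\ tri_of t j)) (adj t j) (adj t j) by exact: connect0.
move: {1 3 4}(adj t j) tt' => y ty t'y /connectP[p pth ->].
elim: p y ty t'y pth => //= y' p IHp y ty t'y /andP[yy' pth].
have t'y' : connect (tree_adj (Y :\ tri_of t j)) (adj t j) y'.
  exact: connect_trans t'y (connect1 yy').
apply: IHp => //; apply: connect_trans ty (connect1 _).
move: yy' => /existsP[k]; rewrite !inE => /andP[/andP[kj kY] /eqP yk].
apply/existsP; exists k; rewrite !inE kY yk eqxx !andbT /=.
have t_out z : connect (tree_adj (Y :\ tri_of t j)) (adj t j) z -> z <> t.
  by move=> t'z zt; move: t_notin; rewrite /branch tri_of_glue -[X in connect _ _ X]zt t'z.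
apply/eqP => /esym/tri_of_eq[[yt _]|[ye ke]]; first exact: t_out t'y yt.
by apply: (t_out y' t'y'); rewrite -yk ye ke adjK.
Qed.

End Trees.

(** * Homology classes and cochains *)

Section Homology.
Local Open Scope ring_scope.
Variable V : transverse_taut.
Implicit Types (t : tet V) (f : tri V) (Y : {set tri V}) (c d : flag V).
Local Notation rot := (@rotate_flag V).

Lemma hclass_is_additive : zmod_morphism (@hclass V).
Proof. exact: pi_is_zmod_morphism. Qed.

HB.instance Definition _ := GRing.isZmodMorphism.Build (cycle1 V) (H1 V)
  (@hclass V) hclass_is_additive.

Lemma cycleP (w : cycle1 V) : bdry1 (w : chain1 V) = 0.
Proof. by apply/eqP; case: w. Qed.

Lemma bdry2_cycleP c : bdry2 c \in @cycle_pred V.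
Proof. by apply/eqP/bdry1_bdry2. Qed.

Definition bdry2_cycle c : cycle1 V := Cycle1 (bdry2_cycleP c).

Lemma hclass_eq0 (w : cycle1 V) : hclass w = 0 <-> torsion_pred w.
Proof.
have piE := Quotient.idealrBE (torsion_boundaries V) w 0.
rewrite subr0 in piE; rewrite -[torsion_pred w]/(w \in torsion_boundaries V) piE.
by rewrite -(raddf0 (@hclass V)); split=> /eqP.
Qed.

(** Evaluation of a cochain with coefficients in [A]. *)
Definition pairing (A : zmodType) (x : tri V -> A) (w : chain1 V) : A :=
  \sum_f x f *~ w f.

Lemma pairing_is_additive (A : zmodType) (x : tri V -> A) : zmod_morphism (pairing x).
Proof.
move=> w w'; rewrite -sumrB; apply: eq_bigr => f _.
by rewrite !ffunE mulrzBr.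
Qed.

HB.instance Definition _ (A : zmodType) (x : tri V -> A) :=
  GRing.isZmodMorphism.Build (chain1 V) A (pairing x) (pairing_is_additive x).

Lemma pairing_single (A : zmodType) (x : tri V -> A) f : pairing x (single f) = x f.
Proof.
rewrite /pairing (bigD1 f) //= big1 ?ffunE ?eqxx ?addr0 // => g gf.
by rewrite ffunE (negPf gf).
Qed.

Lemma pairing_bdry2 (A : zmodType) (x : tri V -> A) c :
  pairing x (bdry2 c) =
  \sum_(d | fconnect rot c d) (if goes_up d then x (across d) else - x (across d)).
Proof.
rewrite bdry2_single raddf_sum; apply: eq_bigr => d _.
rewrite raddfMz /= pairing_single /flag_sign.
by case: goes_up; rewrite ?mulrNz mulr1z.
Qed.

Definition point t : {ffun tet V -> int} := [ffun t' => (t' == t)%:R].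

Lemma bdry1_face t i :
  bdry1 (single (tri_of t i)) = point (tet_above t i) - point (tet_below t i).
Proof. by apply/ffunP=> t'; rewrite bdry1_single !ffunE. Qed.

Lemma path_chain t0 t : exists g : chain1 V, bdry1 g = point t - point t0.
Proof.
have /connectP[p] := tet_connected t0 t; elim: p t0 => [|t1 p IHp] t0 /=.
  by move=> _ ->; exists 0; rewrite raddf0 subrr.
case/andP=> /existsP[i /eqP t01] pth tE; have [g gE] := IHp _ pth tE.
exists (g + single (tri_of t0 i) *~ (if up t0 i then 1 else -1)).
rewrite raddfD raddfMz /= gE bdry1_face /tet_above /tet_below -t01.
case: up; rewrite ?mulrNz mulr1z ?opprB addrA subrK //.
Qed.

(** The potential of a tetrahedron is the value of the cochain on a path from a
    base point; two paths differ by a cycle. *)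
Lemma potential (A : zmodType) (x : tri V -> A) :
    (forall w : cycle1 V, pairing x (w : chain1 V) = 0) ->
  exists b : tet V -> A,
    forall t i, x (tri_of t i) = b (tet_above t i) - b (tet_below t i).
Proof.
move=> x0; have /card_gt0P[t0 _] := tet_gt0 V.
have [g gE] := choice (path_chain t0).
exists (fun t => pairing x (g t)) => t i.
have cyc : single (tri_of t i) - (g (tet_above t i) - g (tet_below t i)) \in @cycle_pred V.
  apply/eqP; rewrite !raddfB /= !gE bdry1_face; apply/eqP.
  by rewrite -opprD subr_eq0 opprB addrA subrK.
have /eqP := x0 (Cycle1 cyc); rewrite /= !raddfB /= pairing_single -opprD subr_eq0.
by move/eqP.
Qed.

(** At each tetrahedron the cycle condition determines one coefficient from the
    three others, which is the step of [tree_induction]. *)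
Lemma cycle_tree_eq0 Y (w : chain1 V) : spanning_tree Y -> bdry1 w = 0 ->
  (forall f, f \notin Y -> w f = 0) -> w = 0.
Proof.
move=> Y_tree w_cyc wY; apply/ffunP=> f; rewrite ffunE; move: f.
apply: (tree_induction Y_tree) => // t i iY w0.
have := congr1 (fun h : {ffun tet V -> int} => h t) w_cyc; rewrite !ffunE.
have [ui|di] := boolP (up t i).
  rewrite big1 ?sub0r => [|j dj]; last by apply: w0; apply: contraNneq dj => ->.
  rewrite (bigD1 i) //= big1 ?addr0 => [/eqP|j /andP[_ ji]]; last exact: w0.
  by rewrite oppr_eq0 => /eqP.
rewrite (bigD1 i) //= big1 ?addr0 => [|j /andP[_ ji]]; last exact: w0.
by rewrite big1 ?subr0 // => j uj; apply: w0; apply: contraNneq di => <-.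
Qed.

End Homology.

(** * Smith normal form and the face Laurents *)

Section Smith.
Local Open Scope ring_scope.

Lemma card_ord_geq n m : #|[set j : 'I_n | (m <= j)%N]| = (n - m)%N.
Proof.
rewrite -sum1_card -[RHS]muln1 -sum_nat_const_nat big_geq_mkord.
by apply: eq_bigl => j; rewrite inE.
Qed.

Lemma upper_set_ord n (A : {set 'I_n}) :
    (forall i j : 'I_n, (i <= j)%N -> i \in A -> j \in A) ->
  forall i : 'I_n, (i \in A) = (n - #|A| <= i)%N.
Proof.
move=> A_up i; apply/idP/idP => [iA|]; last apply: contraTT => iA.
  have : [set j : 'I_n | (i <= j)%N] \subset A.
    by apply/subsetP=> j; rewrite inE => ij; apply: A_up iA.
  by move/subset_leq_card; rewrite card_ord_geq !leq_subLR addnC.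
have : A \subset [set j : 'I_n | (i < j)%N].
  apply/subsetP=> j jA; rewrite inE ltnNge; apply: contra iA => ji.
  exact: A_up jA.
move/subset_leq_card; rewrite card_ord_geq => le_A.
rewrite -ltnNge ltn_subRL; have := leq_add le_A (leqnn i.+1).
by rewrite subnK // addnS.
Qed.

Definition zero_row m n (S : 'M[int]_(m, n)) i := row i S == 0.

(** By divisibility a zero on the diagonal is followed by zeros only. *)
Lemma smith_zero_rows m n (S : 'M[int]_(m, n)) : smith_normal S ->
  forall i, zero_row S i = (m - #|[set i | zero_row S i]| <= i)%N.
Proof.
case=> d d_dvd SE i; rewrite -upper_set_ord ?inE // => {}i j ij; rewrite !inE.
have zeroE k : zero_row S k = (n <= k)%N || (d`_k == 0).
  apply/eqP/idP => [/rowP k0|kn].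
    case: leqP => //= kn; have := k0 (Ordinal kn).
    by rewrite SE !mxE /= eqxx mulr1n => /eqP.
  apply/rowP=> l; rewrite SE !mxE; case: eqP => // kl; rewrite mulr1n.
  by case/orP: kn => [|/eqP//]; rewrite kl leqNgt ltn_ord.
rewrite !zeroE => /orP[ni|/eqP di]; first by rewrite (leq_trans ni).
apply/orP; right; have [jd|/(nth_default 0)-> //] := ltnP j (size d).
have dvd_tr : transitive dvdz by move=> a b c; apply: dvdz_trans.
have dvd_refl : reflexive dvdz by move=> a; apply: dvdzz.
have idm : (i < size d)%N by apply: leq_ltn_trans jd.
have /(_ ij) := sorted_leq_nth dvd_tr dvd_refl 0 d_dvd _ _ idm jd.
by rewrite di -[dvdz _ _]/(0 %| _)%Z dvd0z.
Qed.

(** Each unit vector along a nonzero row has a positive multiple in the image of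
    [S]; the product of these multiples serves all rows at once. *)
Lemma smith_image m n (S : 'M[int]_(m, n)) (x : 'cV[int]_m) : smith_normal S ->
    (forall i, zero_row S i -> x i 0 = 0) ->
  exists2 N, (0 < N)%N & exists y : 'cV[int]_n, S *m y = x *+ N.
Proof.
case=> d _ SE x0.
have unit_image i : exists N_y : nat * 'cV[int]_n, (0 < N_y.1)%N /\
    S *m (x i 0 *: N_y.2) = x i 0 *: delta_mx i 0 *+ N_y.1.
  have [/x0 xi|/eqP nz_i] := boolP (zero_row S i).
    by exists (1%N, 0); rewrite xi !scale0r mulmx0 mul0rn.
  have i_n : (i < n)%N.
    rewrite ltnNge; apply/negP => n_i; apply: nz_i; apply/rowP=> l.
    rewrite SE !mxE; case: eqP => // il; have := ltn_ord l.
    by rewrite -il ltnNge n_i.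
  have d0 : d`_i != 0.
    apply/eqP => di; apply: nz_i; apply/rowP=> l; rewrite SE !mxE.
    by rewrite di mul0rn.
  exists (absz d`_i, sgz d`_i *: delta_mx (Ordinal i_n) 0).
  split; first by rewrite absz_gt0.
  rewrite -!scalemxAr scalerMnr; congr (_ *: _); apply/colP=> k.
  rewrite !mxE -scaler_nat natz (bigD1 (Ordinal i_n)) //= big1 ?addr0.
    rewrite SE !mxE !eqxx; have [->|ki] := eqVneq k i.
      by rewrite /= eqxx !mulr1 abszEsg.
    by rewrite /= (inj_eq val_inj) (negPf ki) mulr0n mul0r !mulr0.
  by move=> l /negPf l_i; rewrite !mxE l_i mulr0.
have [Ny NyP] := choice unit_image.
exists (\prod_i (Ny i).1)%N; first by apply: prodn_gt0 => i; case: (NyP i).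
exists (\sum_i x i 0 *: (Ny i).2 *+ (\prod_(j | j != i) (Ny j).1)%N).
rewrite mulmx_sumr [in RHS](_ : x = \sum_i x i 0 *: delta_mx i 0).
  rewrite -sumrMnl; apply: eq_bigr => i _; rewrite -scaler_nat -scalemxAr.
  case: (NyP i) => _ ->; rewrite scaler_nat -mulrnA; congr (_ *+ _).
  by rewrite [in RHS](bigD1 i).
apply/colP=> k; rewrite summxE (bigD1 k) //= big1 => [|l lk].
  by rewrite !mxE !eqxx mulr1 addr0.
by rewrite !mxE eq_sym (negPf lk) mulr0.
Qed.

End Smith.

Section FaceLaurents.
Local Open Scope ring_scope.
Variables (V : transverse_taut) (p : face_pairings V).
Implicit Types (f : tri V) (w : chain1 V).
Local Notation Y := (fp_tree p).
Local Notation N := #|~: Y|.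
Local Notation U := (fp_U p).
Local Notation r := (fp_rank p).

Lemma fp_lastE (k : 'I_r) : fp_last k = (N - r + k)%N :> nat.
Proof.
rewrite /= subnSK // subnBA; last by rewrite ltnW.
by rewrite addnBAC // fp_rank_le.
Qed.

Lemma fp_last_inj : injective (@fp_last _ p).
Proof.
move=> k l /(congr1 (@nat_of_ord _)); rewrite !fp_lastE => /addnI; exact: val_inj.
Qed.

Lemma zero_row_fp_last i : zero_row (fp_S p) i <-> exists k, i = fp_last k.
Proof.
have zE := smith_zero_rows (fp_smith p); split=> [|[k ->]]; last first.
  by rewrite zE fp_lastE leq_addr.
rewrite zE -[#|[set _ | _]|]/r => le_i; have lt_k : (i - (N - r) < r)%N.
  by rewrite ltn_subLR // subnK ?fp_rank_le.
by exists (Ordinal lt_k); apply: ord_inj; rewrite fp_lastE /= subnKC.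
Qed.

Definition off_tree w : 'cV[int]_N := \col_j w (enum_val j).

Lemma off_tree_is_additive : zmod_morphism off_tree.
Proof. by move=> w w'; apply/colP=> j; rewrite !mxE !ffunE. Qed.

HB.instance Definition _ := GRing.isZmodMorphism.Build (chain1 V) 'cV[int]_N
  off_tree off_tree_is_additive.

Lemma pairing_laurent w k :
  pairing (face_laurent p) w 0 k = (U *m off_tree w) (fp_last k) 0.
Proof.
rewrite summxE mxE; rewrite (eq_bigr (fun f =>
  \sum_(j | enum_val j == f) U (fp_last k) j * w f)).
  rewrite (exchange_big_dep predT) //=; apply: eq_bigr => j _.
  by rewrite (big_pred1 (enum_val j)) ?mxE // => f; rewrite /= eq_sym.
move=> f _; rewrite -mulr_suml.
have -> : (face_laurent p f *~ w f) 0 k = face_laurent p f 0 k * w f.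
  by rewrite -scaler_int mxE intz mulrC.
by rewrite mxE.
Qed.

Lemma off_tree_bdry2 e :
  off_tree (bdry2 (fp_right p e)) = col (enum_rank e) (branch_matrix (fp_right p) Y).
Proof.
have /and3P[ev _ be] := fp_rightP p e.
by apply/colP=> j; rewrite !mxE enum_rankK branch_bdry2.
Qed.

(** Since [U * B = S * V^-1] and the last rows of [S] are 0, the last rows of [U]
    annihilate the branch matrix [B]. *)
Lemma pairing_laurent_bdry2 c : pairing (face_laurent p) (bdry2 c) = 0.
Proof.
have [a ->] := bdry2_span c (fp_rightP p).
rewrite raddfMz /=; suff -> : pairing (face_laurent p) (bdry2 (fp_right p (flag_edge c))) = 0.
  by rewrite mul0rz.
apply/rowP=> k; rewrite pairing_laurent off_tree_bdry2 [RHS]mxE colE mulmxA.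
have -> : U *m branch_matrix (fp_right p) Y = fp_S p *m invmx (fp_V p).
  by rewrite fp_S_eq mulmxK // fp_V_unit.
rewrite -colE !mxE big1 // => j _.
have /eqP/rowP/(_ j) : zero_row (fp_S p) (fp_last k) by apply/zero_row_fp_last; exists k.
by rewrite !mxE => ->; rewrite mul0r.
Qed.

(** Conversely to [pairing_laurent_bdry2], if the last coordinates of [U w] are 0,
    a positive multiple of [U w] is in the image of [S = U * B * V], so that
    multiple of [w] agrees with a boundary off the tree, hence everywhere. *)
Lemma hclass_eq0_laurent (w : cycle1 V) :
  hclass w = 0 <-> pairing (face_laurent p) (w : chain1 V) = 0.
Proof.
rewrite hclass_eq0; split=> [/asboolP[m m0 [k wE]]|w0].
  apply/rowP=> j; have : pairing (face_laurent p) ((w : chain1 V) *+ m) 0 j = 0.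
    rewrite wE raddf_sum summxE big1 // => c _.
    by rewrite raddfMz /= pairing_laurent_bdry2 mul0rz mxE.
  rewrite raddfMn /= mulmxnE mxE => /eqP; rewrite mulrn_eq0.
  by rewrite (gtn_eqF m0) => /eqP.
have [m m0 [y yE]] : exists2 m, (0 < m)%N & exists y : 'cV[int]_#|edg V|,
    fp_S p *m y = (U *m off_tree w) *+ m.
  apply: smith_image; first exact: fp_smith.
  by move=> i /zero_row_fp_last[k ->]; rewrite -pairing_laurent w0 mxE.
apply/asboolP; exists m => //.
pose a e := (fp_V p *m y) (enum_rank e) 0.
exists (fun c => \sum_(e | fp_right p e == c) a e).
transitivity (\sum_e bdry2 (fp_right p e) *~ a e); last first.
  rewrite (partition_big (fp_right p) predT) //=; apply: eq_bigr => c _.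
  by rewrite mulrz_sumr; apply: eq_bigr => e /eqP->.
apply/eqP; rewrite -subr_eq0; apply/eqP; apply: (cycle_tree_eq0 (fp_treeP p)).
  rewrite raddfB raddfMn /= cycleP mul0rn sub0r raddf_sum big1 ?oppr0 // => e _.
  by rewrite raddfMz /= bdry1_bdry2 mul0rz.
have off0 : off_tree ((w : chain1 V) *+ m - \sum_e bdry2 (fp_right p e) *~ a e) = 0.
  apply/eqP; rewrite raddfB subr_eq0 raddfMn raddf_sum /=; apply/eqP.
  apply: (can_inj (mulKmx (fp_U_unit p))).
  rewrite (raddfMn (mulmx U)) -yE fp_S_eq -!mulmxA; congr (U *m _).
  apply/colP=> i; rewrite summxE mxE (reindex _ (onW_bij _ (enum_rank_bij _))).
  apply: eq_bigr => e _; rewrite raddfMz /= off_tree_bdry2.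
  by rewrite -scaler_int intz [RHS]mxE mulrC [in RHS]mxE.
move=> f fY; have fY' : f \in ~: Y by rewrite inE.
have /colP/(_ (enum_rank_in fY' f)) := off0.
by rewrite mxE enum_rankK_in // mxE.
Qed.

Variables (z : 'I_r -> cycle1 V) (z_basis : fp_basis z).
Local Notation mc := (monomial_class z).

Lemma monomial_class_is_additive : zmod_morphism mc.
Proof.
move=> v v'; rewrite -sumrB; apply: eq_bigr => k _.
by rewrite !mxE mulrzBr.
Qed.

HB.instance Definition _ := GRing.isZmodMorphism.Build 'rV[int]_r (H1 V)
  mc monomial_class_is_additive.

Definition monomial_cycle (v : 'rV[int]_r) : cycle1 V := \sum_k z k *~ v 0 k.

Lemma hclass_monomial_cycle v : hclass (monomial_cycle v) = mc v.
Proof. by rewrite raddf_sum; apply: eq_bigr => k _; rewrite raddfMz. Qed.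

Lemma cycle_val_is_additive : zmod_morphism (@cycle_val V).
Proof. by []. Qed.

HB.instance Definition _ := GRing.isZmodMorphism.Build (cycle1 V) (chain1 V)
  (@cycle_val V) cycle_val_is_additive.

Lemma pairing_laurent_basis k :
  pairing (face_laurent p) (z k : chain1 V) = delta_mx 0 k.
Proof.
apply/rowP=> l; rewrite pairing_laurent.
have -> : off_tree (z k) = col (fp_last k) (invmx U) by rewrite -z_basis.
rewrite colE mulmxA mulmxV ?fp_U_unit // mul1mx !mxE eqxx andbT.
by rewrite (inj_eq fp_last_inj).
Qed.

Lemma pairing_laurent_cycle v :
  pairing (face_laurent p) (monomial_cycle v : chain1 V) = v.
Proof.
rewrite !raddf_sum [RHS]row_sum_delta; apply: eq_bigr => k _.
by rewrite !raddfMz /= pairing_laurent_basis -scaler_int intz.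
Qed.

(** The cycle with the same monomial as [w] built from the basis differs from [w]
    by a cycle on which the face Laurents vanish. *)
Lemma hclass_laurent (w : cycle1 V) :
  hclass w = mc (pairing (face_laurent p) (w : chain1 V)).
Proof.
apply/eqP; rewrite -hclass_monomial_cycle -subr_eq0 -raddfB; apply/eqP.
apply/hclass_eq0_laurent; rewrite !raddfB /= pairing_laurent_cycle.
exact: subrr.
Qed.

Lemma monomial_class_inv : exists m' : H1 V -> 'rV[int]_r, cancel mc m' /\ cancel m' mc.
Proof.
have surj h : exists v, mc v = h.
  have [w <-] : exists w : cycle1 V, hclass w = h.
    exists (repr (h : Quotient.quot (torsion_boundaries V))); exact: reprK.
  by exists (pairing (face_laurent p) (w : chain1 V)); rewrite -hclass_laurent.
have [m' m'K] := choice surj; exists m'; split=> // v.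
apply/eqP; rewrite -subr_eq0; apply/eqP; set u := _ - _.
have /hclass_eq0_laurent : hclass (monomial_cycle u) = 0.
  by rewrite hclass_monomial_cycle raddfB /= m'K subrr.
by rewrite pairing_laurent_cycle.
Qed.

End FaceLaurents.

(** * Comparing the entries of the two matrices *)

(** Stated over an abstract ring, so that elements of the group ring are treated
    as atoms. *)
Section RingIdentities.
Local Open Scope ring_scope.
Variable R : comNzRingType.
Implicit Types u w x y : R.

Lemma unit_sandwich x y u : x * y = 1 -> u = 1 -> 1 = x * (1 * u) * y.
Proof. by move=> xy ->; rewrite !mulr1. Qed.

Lemma opp_sandwich x y u w : w = x * u * y -> - w = x * (-1 * u) * y.
Proof. by move=> ->; rewrite mulN1r mulrN mulNr. Qed.

Lemma conjugate_sandwich x x' y y' u : x * x' = 1 -> y * y' = 1 ->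
  u = x * (x' * u * y) * y'.
Proof. by move=> xx yy; rewrite !mulrA xx mul1r -mulrA yy mulr1. Qed.

Lemma tetrahedron_identity (red : bool) (x01 x02 x03 x12 x13 x23 : R) :
  let d := if red then x02 - x23 - x03 else x03 - x02 - x23 in
  let d' := if red then x13 - x23 - x12 else x12 - x13 - x23 in
  (if red then -1 else 1) * d' + (if red then 1 else -1) * d
    + -1 * (x01 - x03 - x13) + 1 * (x01 - x12 - x02) = 0.
Proof. by case: red => /=; ring. Qed.

Lemma triangle_identity (red : bool) (g' g x y z : R) : g' * g = 1 ->
  g' * ((if red then 1 else -1) * (g * x) + -1 * (g * y)
        + (if ~~ red then 1 else -1) * (g * z)) =
  if red then x - y - z else z - x - y.
Proof.
move=> gg; case: red => /=.
  rewrite (_ : _ * _ = (g' * g) * (x - y - z)); first by rewrite gg mul1r.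
  by ring.
rewrite (_ : _ * _ = (g' * g) * (z - x - y)); first by rewrite gg mul1r.
by ring.
Qed.

Lemma scaled_relation (s0 s1 g0 g1 x0 x1 x2 x3 y0 y1 : R) :
    g0 * x0 = y0 -> g1 * x1 = y1 -> s0 * y0 + s1 * y1 + -1 * x2 + 1 * x3 = 0 ->
  s0 * g0 * x0 + s1 * g1 * x1 + -1 * x2 + 1 * x3 = 0.
Proof. by move=> <- <-; rewrite !mulrA. Qed.

Lemma top_identity (x y z : R) : 1 * x + -1 * y + -1 * z = x - y - z.
Proof. by ring. Qed.

End RingIdentities.

Section EdgeCoefficients.
Local Open Scope ring_scope.
Variables (V : transverse_taut) (lam : tri V -> H1 V).
Hypothesis lam_cycle :
  forall w : cycle1 V, pairing lam (w : chain1 V) = hclass w.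
Implicit Types (t : tet V) (f : tri V) (e : edg V) (c d : flag V).
Local Notation rot := (@rotate_flag V).
Local Notation rev := (@reverse_flag V).
Local Notation deck := (deck_step lam).
Local Notation kappa := (edge_coeff lam).

Lemma big_traject (A : nmodType) (F : flag V -> A) c n (P : pred (flag V)) :
  \sum_(d <- traject rot c n | P d) F d =
  \sum_(i < n | P (iter i rot c)) F (iter i rot c).
Proof.
rewrite (big_nth c) size_traject big_mkord; apply: eq_big => i.
  by rewrite nth_traject.
by rewrite nth_traject.
Qed.

(** The loop around an edge bounds, so its class in [H1] is 0. *)
Lemma deck_loop c : \sum_(d <- orbit rot c) deck d = 0.
Proof.
rewrite big_orbit; have := lam_cycle (bdry2_cycle c).
rewrite /= pairing_bdry2 => E; rewrite (eq_bigl (fun d => fconnect rot c d)); last first.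
  by move=> d; rewrite andbT.
rewrite [LHS]E; apply/hclass_eq0/asboolP; exists 1%N => //.
exists (fun d => (d == c)%:Z); rewrite mulr1n (bigD1 c) //= eqxx mulr1z.
by rewrite big1 ?addr0 // => d /negPf->.
Qed.

Lemma edge_coeffE c n : below_edge (iter n rot c) ->
    (forall i, (i < n)%N -> ~~ below_edge (iter i rot c)) ->
  kappa c = \sum_(i < n) deck (iter i rot c).
Proof.
move=> bn nb.
have cn : fconnect rot c (iter n rot c) by apply: fconnect_iter.
have n_o : (n < order rot c)%N.
  apply: leq_ltn_trans (findex_max cn); rewrite leqNgt; apply/negP => /nb.
  by rewrite iter_findex // bn.
have -> : kappa c = \sum_(d <- take n (orbit rot c)) deck d.
  rewrite /edge_coeff; congr (\sum_(d <- take _ _) _).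
  case: findP => [|i i_o bi ni].
    move/hasPn/(_ (iter n rot c)); rewrite -fconnect_orbit cn bn.
    by move/(_ isT).
  rewrite size_orbit in i_o.
  case: (ltngtP i n) => // [/nb|/(ni c)].
    by have := bi c; rewrite nth_traject // => ->.
  by rewrite nth_traject // bn.
by rewrite take_traject ?big_traject // ltnW.
Qed.

Lemma first_below c : even_flag c -> exists2 n, below_edge (iter n rot c) &
  forall i, (i < n)%N -> ~~ below_edge (iter i rot c).
Proof.
move=> ec; have [d cd bd] := exists_below ec.
have ex : exists n, below_edge (iter n rot c).
  by exists (findex rot c d); rewrite iter_findex.
exists (ex_minn ex) => [|i]; case: ex_minnP => // m _ mmin im.
by apply: contraL im => /mmin; rewrite -leqNgt.
Qed.

Lemma edge_coeff_below c : below_edge c -> kappa c = 0.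
Proof. by move=> bc; rewrite (@edge_coeffE c 0) // big_ord0. Qed.

(** Away from the tetrahedron below the edge this is one step of the walk that
    defines [edge_coeff].  At that tetrahedron the walk from [rot c] goes around
    the edge, and the sum of the whole loop is 0. *)
Lemma edge_coeff_rot c : even_flag c -> kappa c = deck c + kappa (rot c).
Proof.
move=> ec; have [bc|nbc] := boolP (below_edge c); last first.
  have [n bn nb] : exists2 n, below_edge (iter n rot (rot c)) &
      forall i, (i < n)%N -> ~~ below_edge (iter i rot (rot c)).
    by apply: first_below; rewrite even_rot.
  rewrite (@edge_coeffE c n.+1) ?iterSr // => [|[|i] //]; last first.
    by rewrite ltnS iterSr; apply: nb.
  rewrite big_ord_recl (edge_coeffE bn nb); congr (_ + _).
  by apply: eq_bigr => i _; rewrite -iterSr.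
rewrite edge_coeff_below // (@edge_coeffE (rot c) (order rot c).-1); first last.
- move=> i io; rewrite -iterSr; apply/negP => bi.
  have := below_unique ec bc bi (fconnect_iter _ _ _).
  move/(congr1 (findex rot c)); rewrite findex_iter -?[X in (_ <= X)%N]orderSpred //.
  by rewrite -[X in findex rot c X]/(iter 0 rot c) findex_iter ?order_gt0.
- by rewrite -iterSr orderSpred iter_order //; exact: rotate_flag_inj.
have := deck_loop c; rewrite /orbit -orderSpred big_traject big_ord_recl.
by move=> E; rewrite -[LHS]E; congr (_ + _); apply: eq_bigr => i _; rewrite -iterSr.
Qed.

(** The walk in the other direction gives the same coefficient: by
    [edge_coeff_rot] the difference is constant along the orbit, and it is 0 below
    the edge. *)
Lemma edge_coeff_rev c : even_flag c -> kappa (rev c) = kappa c.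
Proof.
move=> ec; apply/eqP; rewrite -subr_eq0; apply/eqP.
pose D d := kappa (rev d) - kappa d; rewrite -/(D c).
have D_rot d : even_flag d -> D (rot d) = D d.
  move=> ed; rewrite /D (edge_coeff_rot ed) (@edge_coeff_rot (rev (rot d))).
    rewrite rot_rev_rot /deck_step goes_up_rev_rot across_rev_rot.
    by case: goes_up; rewrite /= opprD ?opprK addrA [_ + kappa (rev d)]addrC.
  by rewrite even_rev even_rot.
have [n bn _] := first_below ec; suff <- : D (iter n rot c) = D c.
  by rewrite /D !edge_coeff_below ?below_edge_rev // subrr.
elim: n {bn} => //= n <-; apply: D_rot.
by rewrite (even_fconnect (fconnect_iter rot n c)).
Qed.

(** After reversal the triangle is the one crossed by the flag, going up, as in
    the lists used by the algorithm. *)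
Lemma DL_entryE e f : DL_entry lam e f =
  \sum_(d | [&& even_flag d, goes_up d, across d == f & flag_edge d == e])
    (if below_edge d then 1 else -1) * gmon (kappa d).
Proof.
rewrite /DL_entry (reindex_inj (inv_inj (@reverse_flagK V))).
apply: eq_big => [d|d /and4P[ed _ _ _]].
  by rewrite rev_v2 flag_edge_rev -[X in X && _]/(even_flag (rev d)) even_rev.
by rewrite below_edge_rev edge_coeff_rev // -even_rev.
Qed.

End EdgeCoefficients.

Section Columns.
Local Open Scope ring_scope.
Variable V : transverse_taut.
Implicit Types (t : tet V) (f : tri V) (e : edg V) (c d : flag V).
Local Notation rot := (@rotate_flag V).
Local Notation rev := (@reverse_flag V).

Lemma tet_below_across d : goes_up d -> tet_below d.1 (d.2 v3) = d.1.
Proof. by rewrite /goes_up /tet_below => ->. Qed.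

Lemma tet_above_across d : goes_up d -> tet_above d.1 (d.2 v3) = (rot d).1.
Proof. by rewrite /goes_up /tet_above => ->. Qed.

Lemma below_triangle f :
  exists t, forall d, goes_up d -> across d = f -> d.1 = t.
Proof.
have [t [i <-]] := tri_of_onto f; exists (tet_below t i) => d ud dE.
rewrite -(tet_below_across ud) /tet_below.
have /tri_of_eq[[-> ->] //|[-> ->]] : tri_of t i = across d by rewrite -dE.
by rewrite up_glue adjK; case: up.
Qed.

Lemma base_flag_tet e c d : base_flag e c -> base_flag e d -> c.1 = d.1.
Proof.
case/and3P=> ec /eqP cE bc /and3P[ed /eqP dE bd].
case: (even_flag_edge_eq ec ed) => [||cd]; first by rewrite cE.
  by move=> /(below_unique ec bc bd) ->.
have -> // : d = rev c.
by apply: below_unique cd; rewrite // ?even_rev ?below_edge_rev.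
Qed.

Lemma base_flag_in_orbit d : even_flag d ->
  exists b, forall c, (base_flag (flag_edge d) c && fconnect rot c d) = (c == b).
Proof.
move=> ed; have [b db bb] := exists_below ed; exists b => c.
apply/andP/eqP => [[/and3P[ec _ bc] cd]|->].
  by apply/esym/below_unique => //; apply: connect_trans cd db.
rewrite fconnect_rot_sym db /base_flag bb (flag_edge_fconnect db) eqxx.
by rewrite -[~~ _]/(even_flag b) (even_fconnect db) ed.
Qed.

(** Every even flag is in the orbit of exactly one flag below its edge, hence it
    occurs in exactly one of the two sides if it goes up. *)
Lemma side_sum (A : zmodType) (G : flag V -> A) e f :
  \sum_(c | base_flag e c) \sum_(d <- up_part c | across d == f) G d =
  \sum_(d | [&& even_flag d, goes_up d, across d == f & flag_edge d == e]) G d.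
Proof.
transitivity (\sum_(c | base_flag e c)
   \sum_(d | fconnect rot c d && (goes_up d && (across d == f))) G d).
  apply: eq_bigr => c /and3P[ec _ bc].
  rewrite up_part_filter // big_filter_cond big_orbit.
  by apply: eq_bigl.
rewrite (exchange_big_dep (fun d =>
  [&& even_flag d, goes_up d, across d == f & flag_edge d == e])) /=.
  apply: eq_bigr => d /and4P[ed ud df /eqP de].
  have [b bE] := base_flag_in_orbit ed.
  rewrite (big_pred1 b) // => c; rewrite /= ud df andbT andbA -bE de.
  by rewrite andbT.
move=> c d /and3P[ec /eqP <- _] /and3P[cd -> ->].
by rewrite (flag_edge_fconnect cd) eqxx (even_fconnect cd) [even_flag c]ec.
Qed.

End Columns.

Section Comparison.
Local Open Scope ring_scope.
Variables (V : transverse_taut) (lam : tri V -> H1 V).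
Hypothesis lam_cycle :
  forall w : cycle1 V, pairing lam (w : chain1 V) = hclass w.
Variables (r : nat) (Lam : tri V -> 'rV[int]_r).
Variable mc : {additive 'rV[int]_r -> H1 V}.
Variable b : tet V -> H1 V.
Hypothesis lamE : forall t i,
  lam (tri_of t i) - mc (Lam (tri_of t i)) = b (tet_above t i) - b (tet_below t i).
Implicit Types (t : tet V) (f : tri V) (e : edg V) (c d : flag V).
Local Notation rot := (@rotate_flag V).
Local Notation kappa := (edge_coeff lam).

(** Along a side the edge coefficient decreases by [lam], and [lam] differs from
    [mc \o Lam] by the coboundary of [b], which telescopes. *)
Lemma kappa_up_part c i : even_flag c -> below_edge c ->
    (forall j, (j < i)%N -> goes_up (iter j rot c)) ->
  mc (\sum_(j < i) - Lam (across (iter j rot c))) =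
  kappa (iter i rot c) + (b (iter i rot c).1 - b c.1).
Proof.
move=> ec bc; elim: i => [|i IHi] ups.
  by rewrite big_ord0 raddf0 /= edge_coeff_below // subrr addr0.
rewrite big_ord_recr raddfD /= IHi => [|j ji]; last exact/ups/ltnW.
have ui := ups i (leqnn _); set d := iter i rot c in ui *.
have ed : even_flag d by rewrite (even_fconnect (fconnect_iter rot i c)).
have := lamE d.1 (d.2 v3); rewrite tet_above_across // tet_below_across //.
rewrite -/(across d) raddfN /= => /(canRL (subrK _)) lamd.
rewrite (edge_coeff_rot lam_cycle ed) /deck_step ui lamd.
rewrite addrAC [X in X + _ = _]addrAC addrK [LHS]addrAC subrKA.
exact: addrC.
Qed.

Lemma gmap_side_entry c f t : even_flag c -> below_edge c ->
    (forall d, goes_up d -> across d = f -> d.1 = t) ->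
  gmap mc (side_entry Lam (side c) f) =
  \sum_(d <- up_part c | across d == f)
    gmon (- b c.1) * ((if below_edge d then 1 else -1) * gmon (kappa d)) * gmon (b t).
Proof.
move=> ec bc t_below.
have /(_ c) up_nth : forall d, exists k, up_part d = traject rot d k.
  move=> d; exists (find (fun d => ~~ goes_up d) (orbit rot d)).
  by rewrite /up_part take_traject // -[X in (_ <= X)%N](size_orbit rot d) find_size.
have [k upE] := up_nth.
have ups i : (i < k)%N -> goes_up (iter i rot c).
  move=> ik; have : iter i rot c \in up_part c.
    by rewrite upE; apply/trajectP; exists i.
  by rewrite up_part_filter // mem_filter => /andP[].
rewrite upE big_traject.
have -> : side c = [seq across d | d <- traject rot c k] by rewrite -upE.
rewrite /side_entry -(big_mkord (fun i => nth f _ i == f)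
  (fun i => if i == 0%N then 1 else - \prod_(g <- take i _) gmon (- Lam g))).
rewrite size_map size_traject big_mkord (raddf_sum (gmap mc)).
apply: eq_big => [i|i].
  by rewrite (nth_map c) ?size_traject // nth_traject.
rewrite (nth_map c) ?size_traject // nth_traject // => /eqP across_f.
have -> : t = (iter i rot c).1 by rewrite -(t_below (iter i rot c)) // ups.
have -> : below_edge (iter i rot c) = (i == 0%N :> nat).
  case: i across_f => -[//|i] ik _ /=; apply/negbTE.
  by rewrite below_edge_rot ups // ltnW.
have -> : - \prod_(g <- take i [seq across d | d <- traject rot c k]) gmon (- Lam g) =
  - gmon (\sum_(j < i) - Lam (across (iter j rot c))).
  by rewrite -map_take take_traject ?(ltnW (ltn_ord i)) // big_map -gmon_sum big_traject.
case: eqP => [i0|_].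
  have -> : iter i rot c = c by rewrite i0.
  apply: (etrans (rmorph1 (gmap mc))); apply: unit_sandwich.
    by rewrite -gmonD addNr.
  by rewrite (edge_coeff_below lam bc).
apply: (etrans (rmorphN (gmap mc) _)); rewrite /= gmap_gmon kappa_up_part //; last first.
  by move=> j ji; apply/ups/(ltn_trans ji).
apply: opp_sandwich; rewrite -!gmonD; congr gmon.
by rewrite addrA [LHS]addrC addrA.
Qed.

Lemma DL_gmap_D_entry e f c t : base_flag e c ->
    (forall d, goes_up d -> across d = f -> d.1 = t) ->
  DL_entry lam e f = gmon (b c.1) * gmap mc (D_entry Lam e f) * gmon (- b t).
Proof.
move=> ec t_below; rewrite DL_entryE // -side_sum /D_entry raddf_sum mulr_sumr mulr_suml.
apply: eq_bigr => c' ec'; have /and3P[ec'0 _ bc'] := ec'.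
rewrite /= (gmap_side_entry ec'0 bc' t_below) mulr_sumr mulr_suml.
apply: eq_bigr => d _; rewrite (base_flag_tet ec ec').
by apply: conjugate_sandwich; rewrite -gmonD subrr.
Qed.

End Comparison.

(** * The columns of the triangles of a tetrahedron *)

Section TriangleColumns.
Local Open Scope ring_scope.
Variables (V : transverse_taut) (lam : tri V -> H1 V).
Hypothesis lam_cycle :
  forall w : cycle1 V, pairing lam (w : chain1 V) = hclass w.
Implicit Types (t : tet V) (f : tri V) (e : edg V) (c d : flag V).
Local Notation rot := (@rotate_flag V).
Local Notation rev := (@reverse_flag V).

(** The edge coefficient as a function of the ends of an edge in a tetrahedron,
    which is well defined because they determine the even flag. *)
Lemma exists_edge_level : exists K : tet V -> 'I_4 -> 'I_4 -> H1 V,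
  forall c, even_flag c -> K c.1 (c.2 v0) (c.2 v1) = edge_coeff lam c.
Proof.
exists (fun t i j =>
  if [pick s : 'S_4 | [&& ~~ odd_perm s, s v0 == i & s v1 == j]] is Some s
  then edge_coeff lam (t, s) else 0) => -[t s] es; case: pickP => /= [q|/(_ s)].
  case/and3P=> eq /eqP q0 /eqP q1; congr (edge_coeff lam (t, _)).
  by apply: even_perm4_eq; rewrite // (negPf eq) (negPf (es : ~~ odd_perm s)).
by rewrite !eqxx andbT [~~ _]es.
Qed.

Definition edge_level := sval (cid exists_edge_level).

Lemma edge_level_flag c : even_flag c ->
  edge_level c.1 (c.2 v0) (c.2 v1) = edge_coeff lam c.
Proof. exact: (svalP (cid exists_edge_level)). Qed.

Lemma edge_levelC t i j : i != j -> edge_level t i j = edge_level t j i.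
Proof.
case/exists_even_perm4 => s [es <- <-]; pose c : flag V := (t, s).
have ec : even_flag c := es.
rewrite (edge_level_flag ec) -(edge_coeff_rev lam_cycle ec) -edge_level_flag.
  by rewrite rev_v0 rev_v1.
by rewrite even_rev.
Qed.

(** If [k] is opposite to the face in front, this is a rotation step; if it is
    opposite to the face behind, it is a rotation step of the reversed flag. *)
Lemma edge_level_cross t i j k : i != j -> k != i -> k != j ->
  edge_level t i j = (if up t k then lam (tri_of t k) else - lam (tri_of t k)) +
    edge_level (adj t k) (glue t k i) (glue t k j).
Proof.
move=> ij ki kj; have [s [es s0 s1]] := exists_even_perm4 ij.
wlog s3 : i j ij ki kj s es s0 s1 / s v3 = k => [at_v3|].
  have [l] : exists l, s l = k by exists (s^-1 k)%g; rewrite permKV.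
  have := ki; have := kj; case: (ord4P l) => -> kj' ki' sk.
  - by move: ki'; rewrite -sk s0 eqxx.
  - by move: kj'; rewrite -sk s1 eqxx.
  - rewrite edge_levelC // [X in _ + X]edge_levelC ?(inj_eq perm_inj) //.
    apply: (at_v3 j i _ kj ki (tperm v0 v1 * tperm v2 v3 * s)%g).
    + by rewrite eq_sym.
    + by rewrite !odd_permM !odd_tperm.
    + by rewrite (rev_v0 (t, s)).
    + by rewrite (rev_v1 (t, s)).
    + by rewrite (rev_v3 (t, s)).
  - exact: (at_v3 i j ij ki kj s).
pose c : flag V := (t, s); have ec : even_flag c := es.
rewrite -s0 -s1 (edge_level_flag ec) (edge_coeff_rot lam_cycle ec) -edge_level_flag.
  by rewrite rot_v0 rot_v1 /deck_step /goes_up /across /= s3.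
by rewrite even_rot.
Qed.

(** Coordinate [e] of the lift of edge [i j] to the tetrahedron [1.t]. *)
Definition edge_term e t i j : groupring (H1 V) :=
  if edg_of t i j == e then gmon (edge_level t i j) else 0.

Definition diagonal_sign t i j : groupring (H1 V) :=
  if top_diagonal t i j then 1 else -1.

Lemma edge_termC e t i j : i != j -> edge_term e t i j = edge_term e t j i.
Proof. by move=> ij; rewrite /edge_term (edg_ofC _ ij) (edge_levelC _ ij). Qed.

Lemma diagonal_signC t i j : diagonal_sign t i j = diagonal_sign t j i.
Proof. by rewrite /diagonal_sign /top_diagonal common_edgeC. Qed.

Lemma edge_term_cross e t i j k : i != j -> k != i -> k != j -> ~~ up t k ->
  edge_term e (adj t k) (glue t k i) (glue t k j) =
  gmon (lam (tri_of t k)) * edge_term e t i j.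
Proof.
move=> ij ki kj /negPf uk; rewrite /edge_term (edg_of_glue t ij ki kj).
case: eqP => _; last by rewrite mulr0.
rewrite -gmonD; congr gmon; rewrite (edge_level_cross t ij ki kj) uk.
by rewrite addrA subrr add0r.
Qed.

(** Symmetry in the ends of the edges makes this hold for odd [s] too. *)
Lemma DL_entry_triangle e t (s : 'S_4) : up t (s v3) ->
  DL_entry lam e (tri_of t (s v3)) =
    diagonal_sign t (s v0) (s v1) * edge_term e t (s v0) (s v1)
  + diagonal_sign t (s v1) (s v2) * edge_term e t (s v1) (s v2)
  + diagonal_sign t (s v2) (s v0) * edge_term e t (s v2) (s v0).
Proof.
pose S i j := diagonal_sign t i j * edge_term e t i j.
have SC i j : i != j -> S i j = S j i.
  by move=> ij; rewrite /S diagonal_signC edge_termC.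
move=> us; rewrite -!/(S _ _).
have main (q : 'S_4) : ~~ odd_perm q -> q v2 = s v3 ->
    DL_entry lam e (tri_of t (s v3)) =
    S (q v0) (q v1) + S (q v1) (q v3) + S (q v3) (q v0).
  move=> eq q2.
  pose F (w : 'S_4) := S (w v0) (w v1).
  have -> : S (q v0) (q v1) + S (q v1) (q v3) + S (q v3) (q v0) =
      F q + F (cyc * q)%g + F (cyc * cyc * q)%g.
    by rewrite /F !permM !cycE.
  rewrite -(big_even_perm4 F eq) /DL_entry.
  rewrite (reindex_onto (fun w : 'S_4 => (t, w)) snd) /=; last first.
    case=> t' w /and4P[_ uw /eqP/tri_of_eq[[-> _ //]|[te we]] _].
    by move: us; rewrite te we up_glue [up _ _]uw.
  rewrite [LHS](eq_bigl (fun w : 'S_4 => (~~ odd_perm w && (w v2 == q v2)) &&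
      (edg_of t (w v0) (w v1) == e))).
    rewrite [LHS]big_mkcondr /=.
    apply: eq_bigr => w /andP[ew _].
    have := edge_level_flag (ew : even_flag (t, w)) => /= <-.
    by rewrite /F /S /edge_term; case: ifP => _; [reflexivity | rewrite mulr0].
  move=> w; rewrite eqxx andbT -andbA; congr (_ && _); rewrite andbA; congr (_ && _).
  rewrite q2; apply/andP/eqP => [[uw /eqP/tri_of_eq[[]//|[te we]]]|->].
    by move: us; rewrite we {1}te up_glue [up _ _]uw.
  by rewrite us eqxx.
have [os|es] := boolP (odd_perm s).
  have m0 : (tperm v2 v3 * s)%g v0 = s v0 by rewrite permM tpermD.
  have m1 : (tperm v2 v3 * s)%g v1 = s v1 by rewrite permM tpermD.
  have m2 : (tperm v2 v3 * s)%g v2 = s v3 by rewrite permM tpermL.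
  have m3 : (tperm v2 v3 * s)%g v3 = s v2 by rewrite permM tpermR.
  rewrite (main (tperm v2 v3 * s)%g) ?m0 ?m1 ?m3 //.
  by rewrite odd_permM odd_tperm os.
rewrite (main (tperm v0 v1 * tperm v2 v3 * s)%g).
- rewrite !(rev_v0 (t, s)) (rev_v1 (t, s)) (rev_v3 (t, s)) /=.
  have neq i j : i != j -> s i != s j by rewrite (inj_eq perm_inj).
  rewrite (SC _ _ (neq v1 v0 isT)) (SC _ _ (neq v0 v2 isT)) (SC _ _ (neq v2 v1 isT)).
  exact: addrAC.
- by rewrite !odd_permM !odd_tperm.
- by rewrite (rev_v2 (t, s)).
Qed.

End TriangleColumns.

(** * The veering relation *)

Section VeeringRelation.
Local Open Scope ring_scope.
Variables (V : veering_triangulation) (lam : tri V -> H1 V).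
Hypothesis lam_cycle :
  forall w : cycle1 V, pairing lam (w : chain1 V) = hclass w.
Implicit Types (t : tet V) (f : tri V) (e : edg V) (c d : flag V) (s : 'S_4).

Definition is_red (c : colour) : bool := if c is Red then true else false.

Lemma top_diagonalE t s : top_diagonal t (s v0) (s v1) = up t (s v2) && up t (s v3).
Proof. exact: (below_edgeE (t, s)). Qed.

Lemma top_diagonalE02 t s : top_diagonal t (s v0) (s v2) = up t (s v1) && up t (s v3).
Proof.
have := top_diagonalE t (tperm v1 v2 * s)%g.
rewrite !(permM (tperm _ _) s) tpermL tpermR.
by rewrite tpermD // tpermD.
Qed.

Lemma top_diagonalE03 t s : top_diagonal t (s v0) (s v3) = up t (s v2) && up t (s v1).
Proof.
have := top_diagonalE t (tperm v1 v3 * s)%g.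
rewrite !(permM (tperm _ _) s) tpermL tpermR.
by rewrite tpermD // tpermD.
Qed.

Lemma top_diagonalE23 t s : top_diagonal t (s v2) (s v3) = up t (s v0) && up t (s v1).
Proof.
pose q : 'S_4 := (tperm v0 v2 * tperm v1 v3)%g.
have q0 : q v0 = v2 by rewrite permM; do 4 rewrite ?permE /=.
have q1 : q v1 = v3 by rewrite permM; do 4 rewrite ?permE /=.
have q2 : q v2 = v0 by rewrite permM; do 4 rewrite ?permE /=.
have q3 : q v3 = v1 by rewrite permM; do 4 rewrite ?permE /=.
by have := top_diagonalE t (q * s)%g; rewrite !(permM q s) q0 q1 q2 q3.
Qed.

Lemma veering_colours t s : ~~ odd_perm s -> up t (s v2) -> up t (s v3) ->
  [/\ is_red (colour_of (edg_of t (s v0) (s v2))),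
      ~~ is_red (colour_of (edg_of t (s v0) (s v3))),
      ~~ is_red (colour_of (edg_of t (s v1) (s v2)))
    & is_red (colour_of (edg_of t (s v1) (s v3)))].
Proof.
move=> es u2 u3; pose c : flag V := (t, s).
have top : top_diagonal t (s v0) (s v1) by rewrite top_diagonalE u2.
have [-> ->] := colour_veering es top.
have topr : top_diagonal t ((reverse_flag c).2 v0) ((reverse_flag c).2 v1).
  by rewrite rev_v0 rev_v1 /top_diagonal common_edgeC.
have er : ~~ odd_perm (reverse_flag c).2 by rewrite [~~ _](even_rev c).
by have [] := colour_veering er topr; rewrite rev_v0 rev_v2 rev_v3 => -> ->.
Qed.

(** The three edges of the bottom triangle opposite to [s v1] are the bottom diagonal
    [s v2, s v3], the red edge [s v0, s v2] and the blue edge [s v0, s v3].  Seen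
    from the tetrahedron [t'] below, one of them is the top diagonal, and the next
    two in the order given by the orientation are red and blue.  This excludes the
    bottom diagonal, and the top diagonal of [t'] is the other edge that has the
    colour of the bottom diagonal. *)
Lemma veering_triangle t s (red := is_red (colour_of (edg_of t (s v2) (s v3)))) :
    ~~ odd_perm s -> up t (s v2) -> up t (s v3) ->
  let t' := adj t (s v1) in let g := glue t (s v1) in
  [/\ top_diagonal t' (g (s v0)) (g (s v2)) = red,
      top_diagonal t' (g (s v0)) (g (s v3)) = ~~ red
    & top_diagonal t' (g (s v2)) (g (s v3)) = false].
Proof.
move=> es u2 u3 t' g; pose w := (s * g)%g.
have wE k : g (s k) = w k by rewrite permM.
have [red02 blue03 _ _] := veering_colours es u2 u3.
have neq i j : i != j -> s i != s j by rewrite (inj_eq perm_inj).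
have eE i j : i != j -> i != v1 -> j != v1 ->
    edg_of t' (w i) (w j) = edg_of t (s i) (s j).
  move=> ij i1 j1; rewrite -!wE; apply: edg_of_glue; first exact: neq.
    by rewrite eq_sym neq.
  by rewrite eq_sym neq.
have u1 : up t (s v1) = false.
  by move: (up_countP t s); rewrite u2 u3; do 2 case: up.
have w1 : up t' (w v1) by rewrite -wE up_glue u1.
have ow : odd_perm w by rewrite odd_permM glue_odd addbT.
rewrite !wE top_diagonalE02 top_diagonalE03 top_diagonalE23 w1 /= !andbT.
have upw := up_countP t' w; rewrite w1 in upw.
(* The top diagonal would be the bottom diagonal of t, and the blue edge would
   have to be red. *)
have [w0|nw0] := boolP (up t' (w v0)).
  pose q : 'S_4 := (tperm v0 v3 * tperm v0 v1 * tperm v0 v2)%g.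
  have q0 : q v0 = v3 by rewrite !permM; do 4 rewrite ?permE /=.
  have q2 : q v2 = v0 by rewrite !permM; do 4 rewrite ?permE /=.
  have q3 : q v3 = v1 by rewrite !permM; do 4 rewrite ?permE /=.
  have oq : odd_perm q by rewrite !odd_permM !odd_tperm.
  have := @veering_colours t' (q * w)%g; rewrite !(permM q w) q0 q2 q3.
  rewrite (odd_permM q w) oq ow => /(_ isT w0 w1)[].
  by rewrite eE // edg_ofC ?neq // (negPf blue03).
rewrite (negPf nw0) in upw.
have [w2|nw2] := boolP (up t' (w v2)).
  have nw3 : up t' (w v3) = false by move: upw; rewrite w2; case: up.
  have := @veering_colours t' (tperm v1 v3 * w)%g; rewrite !(permM _ w).
  rewrite tpermL tpermR (tpermD (z := v0)) // (tpermD (z := v2)) //.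
  rewrite (odd_permM _ w) odd_tperm ow => /(_ isT w2 w1)[_ _].
  rewrite eE // edg_ofC ?neq // -/red => /negPf-> _.
  by rewrite nw3.
have w3 : up t' (w v3) by move: upw; rewrite (negPf nw2); case: up.
pose q : 'S_4 := (tperm v0 v2 * tperm v0 v3 * tperm v0 v1)%g.
have q0 : q v0 = v2 by rewrite !permM; do 4 rewrite ?permE /=.
have q2 : q v2 = v3 by rewrite !permM; do 4 rewrite ?permE /=.
have q3 : q v3 = v1 by rewrite !permM; do 4 rewrite ?permE /=.
have oq : odd_perm q by rewrite !odd_permM !odd_tperm.
have := @veering_colours t' (q * w)%g; rewrite !(permM q w) q0 q2 q3.
rewrite (odd_permM q w) oq ow => /(_ isT w3 w1)[].
by rewrite eE // -/red w3 => -> _ _ _.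
Qed.

Local Notation T := (edge_term lam).

(** The lifts differ by [lam] because the coefficients refer to the tetrahedron
    below the triangle, one level under [t]. *)
Lemma bottom_column e t s (red := is_red (colour_of (edg_of t (s v2) (s v3)))) :
    ~~ odd_perm s -> up t (s v2) -> up t (s v3) ->
  gmon (- lam (tri_of t (s v1))) * DL_entry lam e (tri_of t (s v1)) =
  if red then T e t (s v0) (s v2) - T e t (s v2) (s v3) - T e t (s v0) (s v3)
  else T e t (s v0) (s v3) - T e t (s v0) (s v2) - T e t (s v2) (s v3).
Proof.
move=> es u2 u3; have [d02 d03 d23] := veering_triangle es u2 u3.
set t' := adj t (s v1) in d02 d03 d23 *; set g := glue t (s v1) in d02 d03 d23 *.
have neq i j : i != j -> s i != s j by rewrite (inj_eq perm_inj).
have u1 : ~~ up t (s v1).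
  by move: (up_countP t s); rewrite u2 u3; do 2 case: up.
pose q : 'S_4 := (tperm v1 v2 * tperm v1 v3)%g; pose w := (q * (s * g))%g.
have q0 : q v0 = v0 by rewrite permM; do 4 rewrite ?permE /=.
have q1 : q v1 = v2 by rewrite permM; do 4 rewrite ?permE /=.
have q2 : q v2 = v3 by rewrite permM; do 4 rewrite ?permE /=.
have q3 : q v3 = v1 by rewrite permM; do 4 rewrite ?permE /=.
have w0 : w v0 = g (s v0) by rewrite (permM q) q0 permM.
have w1 : w v1 = g (s v2) by rewrite (permM q) q1 permM.
have w2 : w v2 = g (s v3) by rewrite (permM q) q2 permM.
have w3 : w v3 = g (s v1) by rewrite (permM q) q3 permM.
rewrite -tri_of_glue -/t' -/g -w3 DL_entry_triangle //; last first.
  by rewrite w3 up_glue.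
rewrite w0 w1 w2 (diagonal_signC _ (g (s v3))) /diagonal_sign d02 d03 d23.
rewrite !edge_term_cross ?neq // w3 tri_of_glue (edge_termC lam_cycle _ _ (neq v3 v0 isT)).
by apply: triangle_identity; rewrite -gmonD addNr.
Qed.

Lemma big_ord4_perm (A : zmodType) (F : 'I_4 -> A) s :
  \sum_i F i = F (s v0) + F (s v1) + F (s v2) + F (s v3).
Proof.
rewrite (reindex_inj (@perm_inj _ s)) /= !big_ord_recl big_ord0 addr0 !addrA.
by congr (F (s _) + F (s _) + F (s _) + F (s _)); apply: val_inj.
Qed.

Lemma top_column e t s : up t (s v2) -> up t (s v3) ->
  DL_entry lam e (tri_of t (s v3)) =
  T e t (s v0) (s v1) - T e t (s v1) (s v2) - T e t (s v0) (s v2).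
Proof.
move=> u2 u3; rewrite (DL_entry_triangle lam_cycle e u3).
have neq i j : i != j -> s i != s j by rewrite (inj_eq perm_inj).
have [u0 u1] : up t (s v0) = false /\ up t (s v1) = false.
  by move: (up_countP t s); rewrite u2 u3; do 2 case: up.
rewrite (edge_termC lam_cycle _ _ (neq v2 v0 isT)) (diagonal_signC _ (s v2)).
have d12 : top_diagonal t (s v1) (s v2) = false.
  have := top_diagonalE02 t (tperm v0 v1 * s)%g.
  rewrite !(permM _ s) tpermL tpermR (tpermD (z := v2)) // (tpermD (z := v3)) // => ->.
  by rewrite u0.
rewrite /diagonal_sign top_diagonalE top_diagonalE02 d12 u1 u2 u3.
exact: top_identity.
Qed.

(** The top diagonal cancels in the difference of the two top columns, and the
    bottom diagonal in the difference of the two bottom columns; what remains is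
    the alternating sum of the equatorial edges, up to a sign given by the colour
    of the bottom diagonal. *)
Lemma tetrahedron_relation t : exists2 a : 'I_4 -> groupring (H1 V),
  (forall i, is_unit (a i)) &
  forall e, \sum_i a i * DL_entry lam e (tri_of t i) = 0.
Proof.
have [s [es u2 u3]] : exists s, [/\ ~~ odd_perm s, up t (s v2) & up t (s v3)].
  have /cards2P[a [b [ab upE]]] := introT eqP (up_card t).
  have [q [eq qa qb]] := exists_even_perm4 ab.
  exists (tperm v0 v2 * (tperm v1 v3 * q))%g; split.
  - by rewrite !odd_permM !odd_tperm (negPf eq).
  - rewrite permM tpermR permM tpermD // qa.
    have : a \in [set i | up t i] by rewrite upE !inE eqxx.
    by rewrite inE.
  - rewrite permM tpermD // permM tpermR qb.
    have : b \in [set i | up t i] by rewrite upE !inE eqxx orbT.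
    by rewrite inE.
pose red := is_red (colour_of (edg_of t (s v2) (s v3))).
pose ah (k : 'I_4) : groupring (H1 V) := nth 0
  [:: (if red then -1 else 1) * gmon (- lam (tri_of t (s v0)));
      (if red then 1 else -1) * gmon (- lam (tri_of t (s v1))); -1; 1] k.
exists (fun i => ah (s^-1 i)%g) => [i|e].
  case: (ord4P (s^-1 i)%g) => ->.
  - by apply: is_unitM (gmon_unit _); case: ifP => _; [exact: is_unitN1 | exact: is_unit1].
  - by apply: is_unitM (gmon_unit _); case: ifP => _; [exact: is_unit1 | exact: is_unitN1].
  - exact: is_unitN1.
  - exact: is_unit1.
rewrite (big_ord4_perm _ s) !permK.
have neq i j : i != j -> s i != s j by rewrite (inj_eq perm_inj).
pose s' := (reverse_flag (t, s)).2.
have s'E : (s' v0 = s v1) * (s' v1 = s v0) * (s' v2 = s v3) * (s' v3 = s v2).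
  by rewrite /s' rev_v0 rev_v1 rev_v2 rev_v3.
have es' : ~~ odd_perm s' by rewrite [~~ _](even_rev (t, s)).
have redE : is_red (colour_of (edg_of t (s v3) (s v2))) = red.
  by rewrite edg_ofC ?neq.
have := @bottom_column e t s' es'; cbv zeta; rewrite !s'E redE => /(_ u3 u2) C0.
have := bottom_column e es u2 u3; cbv zeta; rewrite -/red => C1.
have := @top_column e t s'; rewrite !s'E => /(_ u3 u2) C2.
have C3 := top_column e u2 u3.
rewrite (edge_termC lam_cycle _ _ (neq v3 v2 isT)) in C0.
rewrite (edge_termC lam_cycle _ _ (neq v1 v0 isT)) in C2.
apply: (scaled_relation C0 C1); rewrite C2 C3; exact: tetrahedron_identity.
Qed.

End VeeringRelation.

(** * Deleting the columns of a spanning tree *)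

Section TreeColumns.
Local Open Scope ring_scope.
Variables (V : transverse_taut) (R : comNzRingType) (n : nat).
Variable D : 'M[R]_(n, #|tri V|).
Hypothesis D_relation : forall t : tet V, exists2 a : 'I_4 -> R,
  (forall i, is_unit (a i)) &
  forall k, \sum_i a i * D k (enum_rank (tri_of t i)) = 0.
Variable Y : {set tri V}.
Hypothesis Y_tree : spanning_tree Y.

Definition off_tree_columns : 'M[R]_(n, #|~: Y|) :=
  colsub (fun j => enum_rank (enum_val j)) D.

(** At each tetrahedron one column is a combination of the three others, because
    its coefficient in the relation is a unit. *)
Lemma column_in_span f : exists x, col (enum_rank f) D = off_tree_columns *m x.
Proof.
move: f; apply: (tree_induction Y_tree) => [f fY|t i _ others].
  have fY' : f \in ~: Y by rewrite inE.
  exists (delta_mx (enum_rank_in fY' f) 0); rewrite -colE.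
  by apply/colP=> k; rewrite !mxE enum_rankK_in.
have [a a_unit a_rel] := D_relation t; have [b ab] := a_unit i.
have {}others j : exists x, j != i ->
    col (enum_rank (tri_of t j)) D = off_tree_columns *m x.
  by have [->|/others[x xE]] := eqVneq j i; [exists 0 | exists x].
have [x xE] := choice others.
exists (- b *: \sum_(j | j != i) a j *: x j).
rewrite -scalemxAr mulmx_sumr.
rewrite (eq_bigr (fun j => a j *: col (enum_rank (tri_of t j)) D)); last first.
  by move=> j ji; rewrite -scalemxAr -xE.
apply/colP=> k; have := a_rel k; rewrite (bigD1 i) //= => /eqP.
rewrite addrC addr_eq0 => /eqP rel; rewrite !mxE summxE.
rewrite (eq_bigr (fun j => a j * D k (enum_rank (tri_of t j)))); last first.
  by move=> j _; rewrite !mxE.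
by rewrite rel mulrNN mulrA (mulrC b) ab mul1r.
Qed.

(** Either matrix is a product of the other one with a matrix on the right. *)
Lemma common_divisor_off_tree k c :
  common_divisor_of_minors k c D <-> common_divisor_of_minors k c off_tree_columns.
Proof.
split=> cD.
  rewrite /off_tree_columns -[D]mulmx1 -mulmx_colsub.
  exact: common_divisor_mulmxr.
have [x xE] := choice column_in_span.
have -> : D = off_tree_columns *m \matrix_(j, f) x (enum_val f) j 0.
  apply/matrixP=> i f; have /colP/(_ i) := xE (enum_val f).
  rewrite mxE enum_valK => ->; rewrite !mxE; apply: eq_bigr => j _.
  by rewrite !mxE.
exact: common_divisor_mulmxr.
Qed.

End TreeColumns.

(** * The output of the algorithm *)

Section MainTheorem.
Local Open Scope ring_scope.
Variable V : veering_triangulation.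

Lemma DL_relation (lam : tri V -> H1 V) :
    (forall w : cycle1 V, pairing lam (w : chain1 V) = hclass w) ->
  forall t : tet V, exists2 a : 'I_4 -> groupring (H1 V),
    (forall i, is_unit (a i)) &
    forall k, \sum_i a i * DL lam k (enum_rank (tri_of t i)) = 0.
Proof.
move=> lam_cycle t; have [a a_unit aE] := tetrahedron_relation lam_cycle t.
exists a => // k; rewrite -[RHS](aE (enum_val k)); apply: eq_bigr => i _.
by rewrite mxE enum_rankK.
Qed.

Variables (lam : tri V -> H1 V) (p : face_pairings V).
Variables (z : 'I_(fp_rank p) -> cycle1 V) (z_basis : fp_basis z).
Hypothesis lam_cycle :
  forall w : cycle1 V, pairing lam (w : chain1 V) = hclass w.
Variable Y : {set tri V}.
Hypothesis Y_tree : spanning_tree Y.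
Local Notation mc := (monomial_class z).
Local Notation DY := (D_tree (face_laurent p) Y).

(** Both [lam] and the face Laurents compute homology classes of cycles, so they
    differ by the coboundary of a potential [b].  The units are the values of [b]
    at the tetrahedra below the edges and below the triangles. *)
Lemma DL_off_tree_scale : exists (u : 'I_#|edg V| -> groupring (H1 V))
    (v : 'I_#|~: Y| -> groupring (H1 V)),
  [/\ forall i, is_unit (u i), forall j, is_unit (v j) &
      forall i j, off_tree_columns (DL lam) Y i j =
        u i * map_mx (gmap mc) DY i j * v j].
Proof.
have diff_cycle (w : cycle1 V) :
    pairing (fun f => lam f - mc (face_laurent p f)) (w : chain1 V) = 0.
  have -> : pairing (fun f => lam f - mc (face_laurent p f)) (w : chain1 V) =
      pairing lam (w : chain1 V) - mc (pairing (face_laurent p) (w : chain1 V)).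
    rewrite /pairing (raddf_sum mc) -sumrB; apply: eq_bigr => f _.
    by rewrite raddfMz mulrzBl.
  by rewrite lam_cycle (hclass_laurent z_basis) subrr.
have [b bE] := potential diff_cycle.
have [below belowE] := choice (@below_triangle V).
exists (fun i => gmon (b (fp_right p (enum_val i)).1)),
       (fun j => gmon (- b (below (enum_val j)))).
split=> [i|j|i j]; try exact: gmon_unit.
rewrite !mxE enum_rankK.
exact: (DL_gmap_D_entry lam_cycle bE (fp_rightP p _) (belowE _)).
Qed.

Lemma common_divisor_DL c :
  common_divisor_of_minors #|tet V| c (DL lam) <->
  common_divisor_of_minors #|tet V| c (map_mx (gmap mc) DY).
Proof.
rewrite (common_divisor_off_tree (DL_relation lam_cycle) Y_tree).
have [u [v [u_unit v_unit uvE]]] := DL_off_tree_scale.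
exact: common_divisor_unit_scale uvE.
Qed.

(** The inverse of an additive bijection is additive, so it induces the inverse
    map of group rings. *)
Lemma gmap_monomial_class_iso :
  exists g : {rmorphism groupring (H1 V) -> groupring 'rV[int]_(fp_rank p)},
    cancel (gmap mc) g /\ cancel g (gmap mc).
Proof.
have [m [mcK mK]] := monomial_class_inv z_basis.
have m_additive : zmod_morphism m := can2_zmod_morphism mcK mK.
pose madd : {additive H1 V -> 'rV[int]_(fp_rank p)} :=
  HB.pack m (GRing.isZmodMorphism.Build _ _ m m_additive).
by exists (gmap madd); split; apply: gmapK.
Qed.

Lemma taut_polynomial_returned P Theta : TautPolynomial_returns Y P ->
  is_taut_polynomial lam Theta <-> equal_up_to_unit Theta (gmap mc P).
Proof.
have [g [mcK gK]] := gmap_monomial_class_iso.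
have H1_domain (x y : groupring (H1 V)) : x * y = 0 -> x = 0 \/ y = 0.
  move=> xy0; have : g x * g y = 0 by rewrite -rmorphM xy0 rmorph0.
  case/laurent_mul_eq0 => [gx|gy].
    by left; rewrite -(gK x) gx rmorph0.
  by right; rewrite -(gK y) gy rmorph0.
move=> /(is_gcd_minors_map mcK gK) gcdP; rewrite /is_taut_polynomial.
rewrite (is_gcd_eq _ common_divisor_DL); split=> [gcdTheta|].
  exact: is_gcd_unique gcdP.
by move/is_gcd_associate; apply.
Qed.

End MainTheorem.

Theorem proposition5p7 (V : veering_triangulation)
    (lam : tri V -> H1 V) (lam_dom : fundamental_domain lam)
    (p : face_pairings V) (z : 'I_(fp_rank p) -> cycle1 V) (z_basis : fp_basis z)
    (Y : {set tri V}) (Y_tree : spanning_tree Y)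
    (P : groupring 'rV[int]_(fp_rank p)) (P_output : TautPolynomial_returns Y P) :
  bijective (monomial_class z) /\
  forall Theta : groupring (H1 V),
    is_taut_polynomial lam Theta <->
    equal_up_to_unit Theta (gmap (monomial_class z) P).
Proof.
split; first by have [m [mcK mK]] := monomial_class_inv z_basis; exists m.
case: lam_dom => lam_cycle _ Theta.
exact: (taut_polynomial_returned z_basis lam_cycle Y_tree).
Qed.
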